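(* Let $(X,\rho)$ be a proper geodesic metric space homeomorphic to $\mathbb{R}^2$ whose boundary at infinity $\partial X$ is homeomorphic to $\mathbb{S}^1$ and compactifies $X$ so that $X\cup\partial X$ is homeomorphic to the closed unit disk, and which satisfies (G1), (G2) and (G3). Let $P$ be a convex polygon in $X$, let $K$ be a convex polygon in $X$ with $P\cup\partial P\subset K$, and let $d$ be the function on $P\times P$ constructed from $K$, a set $\Theta\subset\partial K$ and weights $(w_i)$ as described in the context. Then $(P,d)$ is a geodesic metric space whose geodesics are precisely the curves $\{\sigma\cap P\mid \sigma \text{ is a geodesic line in } (X,\rho),\ \sigma\cap P\neq\emptyset\}$. In particular, $(P,d)$ is uniquely geodesic and geodesically complete.
   Context: $\partial X$ is the set of asymptoty classes of geodesic rays in $X$, with the topology of uniform convergence on compact sets. Properties: (G1) any two points $x,y\in X$ are joined by a unique geodesic segment $[x,y]$, and every segment $[x,y]$ (with $x\ne y$) extends uniquely to a geodesic line (isometric map $\mathbb{R}\to X$). (G2) for any two distinct $\xi,\eta\in\partial X$ there is a unique geodesic line in $X$ joining them. (G3) for any $x\in X$, $\xi\in\partial X$ there is a unique geodesic ray in $X$ from $x$ to $\xi$. $P\subset X$ is convex if $[x,y]\subset P$ for all $x,y\in P$. A convex polygon in $X$ is a nonempty open bounded convex subset of $X$ whose boundary is a finite union of geodesic segments (its sides). Construction of $d$: $\partial K$ is homeomorphic to a circle; fix a clockwise orientation. For $x\in P$, $\theta\in\partial K$, let $x_\theta\in\partial K$ be the point of $\partial K$ other than $\theta$ at which the geodesic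 line through $\theta$ and $x$ meets $\partial K$. For each $\theta\in\partial K$ there are unique points $\xi_\theta,\eta_\theta\in\partial K$ such that the region bounded by the geodesic segments $[\theta,\xi_\theta]$, $[\theta,\eta_\theta]$ and the arc of $\partial K$ from $\xi_\theta$ to $\eta_\theta$ not containing $\theta$ contains $P$ and is minimal with this property, labelled so that $\theta,\eta_\theta,\xi_\theta$ are in clockwise order. For $a,b$ in the arc of $\partial K$ between $\eta_\theta$ and $\xi_\theta$ not containing $\theta$, $|ab|$ is the length, with respect to $\rho$, of the piecewise geodesic subarc of $\partial K$ between $a$ and $b$ not containing $\theta$. For $x,y\in P$, named so that the clockwise order is $\eta_\theta,y_\theta,x_\theta,\xi_\theta$ (with $x_\theta=y_\theta$ allowed), $$d_\theta(x,y):=\log\frac{|\eta_\theta x_\theta|\,|\xi_\theta y_\theta|}{|\eta_\theta y_\theta|\,|\xi_\theta x_\theta|}.$$ $\Theta=\{\theta_i\mid i\in\mathbb{N}\}$ is a countable dense subset of $\partial K$ containing, for each side of $P$, the two points at which the geodesic line containing that side meets $\partial K$; $w_i>0$ with $\sum_i w_i<\infty$; and $d(x,y):=\sum_{i=1}^\infty w_i\,d_{\theta_i}(x,y)$. A geodesic of $(P,d)$ is the image of an isometric map $\mathbb{R}\to P$; uniquely geodesic means any two points are joined by a unique geodesic segment; geodesically complete means every geodesic segment extends to a geodesic line. *)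

(* Defs.v *)
From HB Require Import structures.
From mathcomp Require Export all_boot all_order all_algebra generic_quotient.
From mathcomp Require Export all_classical all_reals all_analysis.

Set Implicit Arguments.
Unset Strict Implicit.
Unset Printing Implicit Defensive.

Export Order.TTheory GRing.Theory Num.Theory.
Export numFieldNormedType.Exports.

Global Open Scope classical_set_scope.
Global Open Scope ring_scope.
Local Open Scope quotient_scope.

Section topology.

Definition homeomorphic (T U : topologicalType) : Prop :=
  exists (f : T -> U) (g : U -> T),
    [/\ cancel f g, cancel g f, continuous f & continuous g].

Definition frontier (T : topologicalType) (A : set T) : set T :=
  closure A `\` interior A.

Definition unit_circle (R : realType) : set (R * R) :=
  [set p | p.1 ^+ 2 + p.2 ^+ 2 = 1].

Definition closed_unit_disk (R : realType) : set (R * R) :=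
  [set p | p.1 ^+ 2 + p.2 ^+ 2 <= 1].

End topology.

(* A set [D] with a distance [dist] that is only meaningful on [D]: used both
   for [(X, rho)], with [D] the full set, and for [(P, d)]. *)
Section metric_geometry.
Context {R : realType} {T : Type} (D : set T) (dist : T -> T -> R).

Definition metric_on : Prop :=
  [/\ forall x y, D x -> D y -> 0 <= dist x y,
      forall x y, D x -> D y -> (dist x y = 0 <-> x = y),
      forall x y, D x -> D y -> dist x y = dist y x &
      forall x y z, D x -> D y -> D z -> dist x z <= dist x y + dist y z].

Definition isometric_on (I : set R) (c : R -> T) : Prop :=
  (forall t, I t -> D (c t)) /\
  (forall s t, I s -> I t -> dist (c s) (c t) = `|s - t|).

Definition geodesic_segment (x y : T) (S : set T) : Prop :=
  exists (L : R) (c : R -> T),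
    [/\ 0 <= L, isometric_on `[0, L] c, c 0 = x, c L = y & S = c @` `[0, L]].

Definition geodesic_line (S : set T) : Prop :=
  exists2 c : R -> T, isometric_on setT c & S = range c.

Definition geodesic_space : Prop :=
  forall x y, D x -> D y -> exists S, geodesic_segment x y S.

Definition uniquely_geodesic : Prop :=
  forall x y, D x -> D y -> exists! S, geodesic_segment x y S.

Definition geodesically_complete : Prop :=
  forall x y S, D x -> D y -> geodesic_segment x y S ->
    exists2 s, geodesic_line s & S `<=` s.

End metric_geometry.

Section boundary_at_infinity.
Context {R : realType} (X : metricType R).

Definition proper_space : Prop :=
  forall (x : X) (r : R), compact [set y | mdist x y <= r].

(* A ray [0, +oo[ -> X is encoded as a map on the whole of R that is constant
   on ]-oo, 0]; this changes neither equality of rays nor uniform convergence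
   on compact sets. *)
Definition geodesic_ray (c : R -> X) : Prop :=
  forall s t, mdist (c s) (c t) = `|Num.max 0 s - Num.max 0 t|.

Definition stopped_ray (c : R -> X) : Prop :=
  exists2 L : R, 0 <= L & forall s t,
    mdist (c s) (c t) =
      `|Num.min L (Num.max 0 s) - Num.min L (Num.max 0 t)|.

Definition asymptotic (c c' : R -> X) : Prop :=
  exists M : R, forall t, 0 <= t -> mdist (c t) (c' t) <= M.

(* Rays and generalized rays, with the topology of uniform convergence on
   compact sets. *)
Definition ray : topologicalType :=
  set_type [set c : {family compact, R -> X} | geodesic_ray c].

Definition generalized_ray : topologicalType :=
  set_type [set c : {family compact, R -> X} |
            geodesic_ray c \/ stopped_ray c].

Definition asymptotic_rel : rel ray :=
  fun c c' => `[< asymptotic (val c) (val c') >].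

Definition eventually_at (c : R -> X) (z : X) : Prop :=
  \forall t \near +oo, c t = z.

Definition same_end_rel : rel generalized_ray :=
  fun c c' => `[< asymptotic (val c) (val c') /\
    forall z, eventually_at (val c) z <-> eventually_at (val c') z >].

Lemma asymptotic_refl (c : R -> X) : asymptotic c c.
Proof. by exists 0 => t _; rewrite mdistxx. Qed.

Lemma asymptotic_sym (c c' : R -> X) : asymptotic c c' -> asymptotic c' c.
Proof. by move=> [M h]; exists M => t t0; rewrite metric_sym h. Qed.

Lemma asymptotic_trans (c2 c1 c3 : R -> X) :
  asymptotic c1 c2 -> asymptotic c2 c3 -> asymptotic c1 c3.
Proof.
move=> [M h] [N k]; exists (M + N) => t t0.
by apply: (le_trans (metric_triangle _ (c2 t) _)); rewrite lerD ?h ?k.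
Qed.

Lemma asymptotic_rel_refl : reflexive asymptotic_rel.
Proof. by move=> c; apply/asboolP; exact: asymptotic_refl. Qed.

Lemma asymptotic_rel_sym : symmetric asymptotic_rel.
Proof. by move=> c c'; apply/asboolP/asboolP; exact: asymptotic_sym. Qed.

Lemma asymptotic_rel_trans : transitive asymptotic_rel.
Proof.
move=> c2 c1 c3 /asboolP h /asboolP k; apply/asboolP.
exact: asymptotic_trans h k.
Qed.

Lemma same_end_rel_refl : reflexive same_end_rel.
Proof. by move=> c; apply/asboolP; split=> //; exact: asymptotic_refl. Qed.

Lemma same_end_rel_sym : symmetric same_end_rel.
Proof.
by move=> c c'; apply/asboolP/asboolP => -[/asymptotic_sym h k];
  split=> // z; split=> /k.
Qed.

Lemma same_end_rel_trans : transitive same_end_rel.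
Proof.
move=> c2 c1 c3 /asboolP[h h'] /asboolP[k k']; apply/asboolP; split.
  exact: asymptotic_trans h k.
by move=> z; split=> [/h' /k'//|/k' /h'].
Qed.

Canonical asymptotic_equiv :=
  EquivRel asymptotic_rel
    asymptotic_rel_refl asymptotic_rel_sym asymptotic_rel_trans.

Canonical same_end_equiv :=
  EquivRel same_end_rel
    same_end_rel_refl same_end_rel_sym same_end_rel_trans.

Definition ideal_boundary : topologicalType :=
  quotient_topology {eq_quot asymptotic_equiv}.

Definition ideal_point (c : ray) : ideal_boundary :=
  \pi_{eq_quot asymptotic_equiv} c.

(* X together with its boundary at infinity, carrying the cone topology.  A
   generalized ray is a geodesic ray or a geodesic segment continued by its
   last point, and its class is, respectively, its asymptoty class or the point
   at which it stops: two stopped rays are identified iff they stop at the same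
   point, two geodesic rays iff they are asymptotic, and a stopped ray is never
   identified with a geodesic ray. *)
Definition compactification : topologicalType :=
  quotient_topology {eq_quot same_end_equiv}.

Definition line_of : set X -> Prop := geodesic_line setT (@mdist R X).

Definition segment_of : X -> X -> set X -> Prop :=
  geodesic_segment setT (@mdist R X).

Definition segment (x y : X) : set X := xget set0 [set S | segment_of x y S].

Definition joins (s : set X) (xi eta : ideal_boundary) : Prop :=
  exists2 c : R -> X, isometric_on setT (@mdist R X) setT c & s = range c /\
    exists r r' : ray,
      [/\ ideal_point r = xi, ideal_point r' = eta,
          forall t, 0 <= t -> val r t = c t &
          forall t, 0 <= t -> val r' t = c (- t)].

Definition G1 : Prop :=
  (forall x y : X, exists! S, segment_of x y S) /\
  (forall (x y : X) (S : set X), x <> y -> segment_of x y S ->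
     exists! s, line_of s /\ S `<=` s).

Definition G2 : Prop :=
  forall xi eta : ideal_boundary, xi <> eta -> exists! s, joins s xi eta.

Definition G3 : Prop :=
  forall (x : X) (xi : ideal_boundary),
    exists! r : ray, val r 0 = x /\ ideal_point r = xi.

End boundary_at_infinity.

Section polygons.
Context {R : realType} {X : metricType R}.

Definition metric_bounded (A : set X) : Prop :=
  exists M : R, forall x y, A x -> A y -> mdist x y <= M.

Definition geodesically_convex (A : set X) : Prop :=
  forall x y, A x -> A y -> segment x y `<=` A.

(* A side is given by its pair of (distinct) endpoints. *)
Definition polygon_with_sides (A : set X) (sides : seq (X * X)) : Prop :=
  [/\ A !=set0, open A, metric_bounded A, geodesically_convex A &
      (forall e, e \in sides -> e.1 <> e.2) /\
      frontier A = \bigcup_(e in [set` sides]) segment e.1 e.2].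

Definition convex_polygon (A : set X) : Prop :=
  exists sides, polygon_with_sides A sides.

(* A homeomorphism from the circle R/Z onto [C]; the direction of increasing
   parameter is the clockwise direction. *)
Definition clockwise_parametrization (C : set X) (g : R -> X) : Prop :=
  [/\ continuous g, forall t, g (t + 1) = g t,
      {in `[0, 1[ &, injective g} & range g = C].

(* Same conventions as [variations] and [total_variation] for real-valued
   functions. *)
Definition curve_length (a b : R) (f : R -> X) : R :=
  sup [set l | exists2 s, itv_partition a b s &
    l = \sum_(0 <= n < size s) mdist (f (nth b (a :: s) n)) (f (nth b s n))].

End polygons.

Section construction.
Context {R : realType} {X : metricType R}.
Variables (K P : set X) (g : R -> X).

Definition base (th : X) : R := xget 0 [set s | g s = th].

(* The parameter at which [a], different from [th], is reached when running
   once clockwise around the curve from [th]. *)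
Definition pos (th a : X) : R :=
  xget 0 [set t | base th < t < base th + 1 /\ g t = a].

Definition arc (th a b : X) : set X :=
  g @` `[Num.min (pos th a) (pos th b), Num.max (pos th a) (pos th b)].

Definition arc_length (th a b : X) : R :=
  curve_length (Num.min (pos th a) (pos th b))
               (Num.max (pos th a) (pos th b)) g.

Definition second_point (th x : X) : X :=
  xget th [set z | [/\ frontier K z, z <> th &
                       exists s, [/\ line_of s, s th, s x & s z]]].

(* The union of the bounded connected components of the complement; the inside
   of [J] when [J] is a simple closed curve. *)
Definition region_bounded_by (J : set X) : set X :=
  [set z | (~` J) z /\ metric_bounded (connected_component (~` J) z)].

Definition sector (th eta xi : X) : set X :=
  region_bounded_by (segment th xi `|` segment th eta `|` arc th xi eta).

Definition sector_candidate (th eta xi : X) : Prop :=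
  [/\ frontier K eta, frontier K xi, eta <> th, xi <> th &
      P `<=` sector th eta xi].

Definition tangent_points (th : X) (p : X * X) : Prop :=
  let: (eta, xi) := p in
  [/\ sector_candidate th eta xi,
      forall eta' xi', sector_candidate th eta' xi' ->
        sector th eta' xi' `<=` sector th eta xi ->
        sector th eta' xi' = sector th eta xi &
      pos th eta < pos th xi].

Definition eta_of (th : X) : X := (xget (th, th) (tangent_points th)).1.

Definition xi_of (th : X) : X := (xget (th, th) (tangent_points th)).2.

Definition log_ratio (th x y : X) : R :=
  let len := arc_length th in
  ln ((len (eta_of th) (second_point th x) * len (xi_of th) (second_point th y))
    / (len (eta_of th) (second_point th y) * len (xi_of th) (second_point th x))).

Definition dist_theta (th x y : X) : R :=
  if pos th (second_point th y) <= pos th (second_point th x)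
  then log_ratio th x y else log_ratio th y x.

Definition polygon_dist (theta : nat -> X) (w : nat -> R) (x y : X) : R :=
  limn (series (fun i => w i * dist_theta (theta i) x y)).

End construction.

(* Main.v *)
(* For [th] on the frontier of [K], record a point [x] of [P] by the position
   along the frontier of [x_th] (its "shadow"). Since two geodesic lines meet
   at most once and geodesics depend continuously on their ends, the shadow is
   continuous and, along a geodesic not through [th], injective, hence
   monotone. The tangent points [eta_th] and [xi_th] are the ends of the shadow
   of [P], so [d_th x y = |F x - F y|] where [F] is an increasing function of
   the shadow. Hence every [d_th], and so [d], is additive along geodesics of
   [X]. If [y] is not on the segment [x, z], then seen from [th] close to an
   end of the line through [x] and [z] the shadow of [y] is not between those
   of [x] and [z], so the triangle inequality is strict. Finally, at a boundary
   point of [P] the term of [d] belonging to an end of the line through the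
   corresponding side blows up, which makes the geodesics complete. *)
Require Import Defs.
From mathcomp Require Import lra ring.

Set Implicit Arguments.
Unset Strict Implicit.
Unset Printing Implicit Defensive.

(** * Limits along ultrafilters *)

Section ultrafilters.

(** Sectors are defined through bounded complementary components of a closed curve, so each must be
    identified with a set of points of [K] whose shadow lies in an open interval. A point off the
    curve and outside this set escapes along a geodesic ray that avoids the curve; the set itself is
    open, and closed relative to the complement of the curve. The sides of [K] come as an unordered
    list, not as a subdivision of the parameter circle. Hence [g] is only shown to be geodesic on
    some one-sided neighbourhood of each parameter, and finiteness of arc length follows by a
    supremum argument. Convergence of the series needs, for fixed [x], a bound on the potentials
    uniform in [th]: by compactness of the frontier of [K], the tangent points stay away from the
    second point of [x]. Limits are taken along ultrafilters: in a compact set they exist without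
    extracting subsequences, and uniqueness of geodesics identifies them. The metric conclusions are
    then drawn for any sum of [w i * |f i x - f i y|] whose [f i] are pointwise bounded uniformly in
    [i], monotone and continuous along lines, separating off segments, and blowing up at the
    frontier. *)

Lemma cvg_finer (T : Type) (U : topologicalType) (F G : set_system T)
  (f : T -> U) (l : U) : F `<=` G -> f @ F --> l -> f @ G --> l.
Proof. by move=> FG fl B Bl; apply: FG; exact: fl. Qed.

(** If a neighbourhood had a preimage outside [F], then [F] together with the complement of that
    preimage would extend to an ultrafilter along which the limit fails. Thus a limit only has to be
    identified where compactness already provides one. *)
Lemma cvg_ultra (T : Type) (U : topologicalType) (F : set_system T)
    {FF : Filter F} (f : T -> U) (l : U) :
  (forall G, UltraFilter G -> F `<=` G -> f @ G --> l) -> f @ F --> l.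
Proof.
move=> h B Bl; apply: contrapT => nFB.
pose D := ~` (f @^-1` B).
have PF : ProperFilter (within D F).
  apply: Build_ProperFilter; rewrite /within /= => FD.
  by apply: nFB; apply: filterS FD => x; rewrite /D /= => /contrapT.
have [G [GU FG]] := ultraFilterLemma PF.
have FG' : F `<=` G by move=> A FA; apply: FG; apply: filterS FA.
have GD : G D by apply: FG; rewrite /within /=; apply: filterE.
have GB : G (f @^-1` B) by exact: (h G GU FG' B Bl).
by have /filter_ex[x [/=]] : G (D `&` f @^-1` B) by exact: filterI.
Qed.

(** The image of an ultrafilter is an ultrafilter, because [G] decides every preimage; on a compact
    set it converges. *)
Lemma ultra_compact_cvg (T : Type) (U : topologicalType) (G : set_system T)
    {GU : UltraFilter G} (f : T -> U) (A : set U) :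
  compact A -> (\forall x \near G, A (f x)) -> exists2 p, A p & f @ G --> p.
Proof.
move=> + GA; have UfG : UltraFilter (f @ G).
  split; first exact: fmap_proper_filter.
  move=> H PH sH; apply/seteqP; split => // B HB.
  have [//|GnB] := in_ultra_setVsetC (f @^-1` B) GU.
  have HnB : H (~` B) by exact: sH.
  by have /filter_ex[x []] : H (B `&` ~` B) by exact: filterI.
rewrite compact_ultra => /(_ (f @ G) UfG GA)[p [Ap fp]].
by exists p.
Qed.

End ultrafilters.

Section metric_limits.
Context {R : realType} {X : metricType R}.

Lemma cvg_mdist (T : Type) (F : set_system T) {FF : Filter F}
    (x y : T -> X) (a b : X) : x @ F --> a -> y @ F --> b ->
  mdist (x t) (y t) @[t --> F] --> mdist a b.
Proof.
move=> /metricType_numDomainType.cvgrPdist_lt xa /metricType_numDomainType.cvgrPdist_lt yb.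
apply/cvgrPdist_lt => e e0.
near=> t.
have h1 : mdist a (x t) < e / 2 by near: t; apply: xa; lra.
have h2 : mdist b (y t) < e / 2 by near: t; apply: yb; lra.
have t1 := metric_triangle a (x t) b.
have t2 := metric_triangle (x t) (y t) b.
have t3 := metric_triangle (x t) a (y t).
have t4 := metric_triangle a b (y t).
rewrite (metric_sym (y t) b) (metric_sym (x t) a) in t2 t3.
rewrite ltr_norml; apply/andP; split; lra.
Unshelve. all: by end_near. Qed.

Lemma cvg_mdist0 (T : Type) (F : set_system T) {FF : Filter F}
    (x y : T -> X) (a : X) : x @ F --> a ->
  mdist (x t) (y t) @[t --> F] --> (0 : R) -> y @ F --> a.
Proof.
move=> /metricType_numDomainType.cvgrPdist_lt xa /cvgrPdist_lt yx.
apply/metricType_numDomainType.cvgrPdist_lt => e e0; near=> t.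
have h1 : mdist a (x t) < e / 2 by near: t; apply: xa; lra.
have h2 : `|0 - mdist (x t) (y t)| < e / 2 by near: t; apply: yx; lra.
have t1 := metric_triangle a (x t) (y t).
move: h2; rewrite sub0r normrN ger0_norm ?mdist_ge0// => h2; lra.
Unshelve. all: by end_near. Qed.

Lemma cvg_uniq (T : Type) (F : set_system T) {FF : ProperFilter F}
  (x : T -> X) (a b : X) : x @ F --> a -> x @ F --> b -> a = b.
Proof. by move=> xa xb; apply: (@cvg_unique _ (@metric_hausdorff R X) (x @ F)). Qed.

Lemma cvgr_uniq (T : Type) (F : set_system T) {FF : ProperFilter F}
  (x : T -> R) (a b : R) : x @ F --> a -> x @ F --> b -> a = b.
Proof.
by move=> xa xb; apply: (@cvg_unique _ (@norm_hausdorff R R) (x @ F)).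
Qed.

Lemma ler_cvg_lim (T : Type) (F : set_system T) {FF : ProperFilter F}
    (x y : T -> R) (a b : R) : x @ F --> a -> y @ F --> b ->
  (\forall t \near F, x t <= y t) -> a <= b.
Proof.
move=> xa yb xy; rewrite leNgt; apply/negP => ba.
have /filter_ex[t [[]]] : \forall t \near F,
    ((a + b) / 2 < x t /\ y t < (a + b) / 2) /\ x t <= y t.
  apply: filterI => //; apply: filterI; [apply: (cvgr_gt _ xa)|
    apply: (cvgr_lt _ yb)]; lra.
by move=> h1 h2; rewrite leNgt (lt_trans h2 h1).
Qed.

Lemma closed_cvgW (T : Type) (F : set_system T) {FF : ProperFilter F}
  (x : T -> X) (a : X) (A : set X) : closed A ->
  (\forall t \near F, A (x t)) -> x @ F --> a -> A a.
Proof. by move=> cA FA xa; apply: (closed_cvg _ cA FA). Qed.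

End metric_limits.

Lemma continuous_inj_between (R : realType) (f : R -> R) a b :
  {within `[a, b], continuous f} -> {in `[a, b] &, injective f} ->
  forall s r u, a <= s -> s < r -> r < u -> u <= b ->
  f s < f r < f u \/ f u < f r < f s.
Proof.
move=> fc fi s r u as_ sr ru ub.
have hs : s \in `[a, b] by rewrite in_itv /=; lra.
have hr : r \in `[a, b] by rewrite in_itv /=; lra.
have hu : u \in `[a, b] by rewrite in_itv /=; lra.
have [h|h] := itv_continuous_inj_mono fc fi; [left|right].
  by rewrite !h.
by rewrite !h.
Qed.

(** * Geodesic lines *)

Section geodesic_lines.
Context {R : realType} {X : metricType R}.
Hypothesis g1 : G1 X.

Definition isoline (c : R -> X) : Prop :=
  forall s t, mdist (c s) (c t) = `|s - t|.

Lemma isoline_line_of c : isoline c -> line_of (range c).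
Proof. by move=> ci; exists c. Qed.

Lemma line_ofP s : line_of s -> exists2 c, isoline c & s = range c.
Proof. by move=> [c [_ ci] ->]; exists c => // u v; exact: ci. Qed.

Lemma isoline_inj c : isoline c -> injective c.
Proof.
move=> ci a b cab; have := ci a b.
by rewrite cab mdistxx => /esym/eqP; rewrite normr_eq0 subr_eq0 => /eqP.
Qed.

Lemma isoline_shift c a : isoline c -> isoline (fun t => c (a + t)).
Proof. by move=> ci s t; rewrite ci; congr `|_|; ring. Qed.

Lemma isoline_flip c a : isoline c -> isoline (fun t => c (a - t)).
Proof. by move=> ci s t; rewrite ci distrC; congr `|_|; ring. Qed.

Lemma isoline_segment_of c a b : isoline c -> a <= b ->
  segment_of (c a) (c b) (c @` `[a, b]).
Proof.
move=> ci ab; exists (b - a), (fun t => c (a + t)); split => //.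
- by rewrite subr_ge0.
- by split=> // s t _ _; rewrite isoline_shift.
- by rewrite addr0.
- by rewrite addrC subrK.
- apply/seteqP; split => _ /= [t + <-]; rewrite in_itv /= => /andP[h1 h2].
    by exists (t - a); [rewrite in_itv /=; lra|congr c; ring].
  by exists (a + t) => //; rewrite in_itv /=; lra.
Qed.

(** Both lines contain the unique segment between the two common points, so unique extension gives
    them the same range. The distances to two distinct points of a line then determine the
    parameter. *)
Lemma isoline_uniq c c' a b : isoline c -> isoline c' -> a <> b ->
  c a = c' a -> c b = c' b -> c = c'.
Proof.
move=> ci ci'; wlog ab : a b / a < b => [hw ab ca cb|_ ca cb].
  have [h|h|//] := ltgtP a b; first exact: (hw a b).
  by apply: (hw b a) => //; exact/nesym.
have [[S [_ Su]] ext] := (g1.1 (c a) (c b), g1.2).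
have S1 := isoline_segment_of ci (ltW ab).
have S2 := isoline_segment_of ci' (ltW ab); rewrite -ca -cb in S2.
have SE : c @` `[a, b] = c' @` `[a, b] by rewrite -(Su _ S1) -(Su _ S2).
have cab : c a <> c b by move/(isoline_inj ci) => E; rewrite E ltxx in ab.
have [s [_ su]] := ext _ _ _ cab S1.
have r1 : range c = range c'.
  rewrite -(su (range c)); last first.
    by split; [exact: isoline_line_of|move=> _ [t _ <-]; exists t].
  apply: su; split; first exact: isoline_line_of.
  by rewrite SE => _ [t _ <-]; exists t.
apply/funext => t; have [u _ cu] : range c' (c t) by rewrite -r1; exists t.
have := ci' u a; rewrite cu -ca ci => ha.
have := ci' u b; rewrite cu -cb ci => hb.
rewrite -cu; congr c'; move: ha hb.
by case: (ler0P (t - a)); case: (ler0P (u - a)); case: (ler0P (t - b));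
  case: (ler0P (u - b)) => *; lra.
Qed.

(** The default value is constant at [x], so that [gline x y 0 = x] holds even when [x = y]. *)
Definition gline (x y : X) : R -> X :=
  xget (fun=> x) [set c | [/\ isoline c, c 0 = x & c (mdist x y) = y]].

Lemma gline0 x y : gline x y 0 = x.
Proof. by rewrite /gline; case: xgetP => // c _ [_ ->]. Qed.

Lemma isoline_ex x y : x <> y ->
  exists c, [/\ isoline c, c 0 = x & c (mdist x y) = y].
Proof.
move=> xy; have [[S [Sxy _]] ext] := (g1.1 x y, g1.2).
have [s [[/line_ofP[c ci ->] Ss] _]] := ext _ _ _ xy Sxy.
have [L [e [L0 _ e0 eL SE]]] := Sxy.
have [a _ ca] : range c x.
  by apply: Ss; rewrite SE; exists 0 => //=; rewrite in_itv /= lexx.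
have [b _ cb] : range c y.
  by apply: Ss; rewrite SE; exists L => //=; rewrite in_itv /= lexx andbT.
rewrite -ca -cb ci; have [ab|ab] := leP a b.
  exists (fun t => c (a + t)); split => //; first exact: isoline_shift.
    by rewrite addr0.
  by rewrite distrC ger0_norm ?subr_ge0// addrC subrK.
exists (fun t => c (a - t)); split => //; first exact: isoline_flip.
  by rewrite subr0.
by rewrite ger0_norm ?subr_ge0 ?(ltW ab)//; congr c; ring.
Qed.

Lemma glineP x y : x <> y -> isoline (gline x y) /\ gline x y (mdist x y) = y.
Proof.
move=> /isoline_ex[c cP]; rewrite /gline; case: xgetP => [d _ []//|].
by move=> /(_ c).
Qed.

Lemma gline_iso x y : x <> y -> isoline (gline x y).
Proof. by move=> /glineP[]. Qed.

Lemma gline1 x y : x <> y -> gline x y (mdist x y) = y.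
Proof. by move=> /glineP[]. Qed.

Lemma mdist_gline x y v : x <> y -> mdist x (gline x y v) = `|v|.
Proof.
by move=> xy; rewrite -{1}(gline0 x y) gline_iso// sub0r normrN.
Qed.

Lemma gline_lt c a b : isoline c -> a < b ->
  gline (c a) (c b) = fun t => c (a + t).
Proof.
move=> ci ab; have cab : c a <> c b.
  by move/(isoline_inj ci) => E; rewrite E ltxx in ab.
have [h1 h2] := glineP cab.
apply: (@isoline_uniq _ _ 0 (b - a)) => //; first exact: isoline_shift.
- by move=> h; lra.
- by rewrite gline0 addr0.
- by move: h2; rewrite ci distrC gtr0_norm ?subr_gt0// => ->; congr c; ring.
Qed.

Lemma gline_gt c a b : isoline c -> b < a ->
  gline (c a) (c b) = fun t => c (a - t).
Proof.
move=> ci ab; have := @gline_lt (fun t => c (a - t)) 0 (a - b).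
rewrite subr0 opprB addrCA subrr addr0 => ->; rewrite ?subr_gt0//.
  by apply/funext => t; rewrite add0r.
exact: isoline_flip.
Qed.

(** Two parametrizations sharing two points differ by a translation or a reflection of the real
    line, according to the direction in which they pass through these points. Either one is
    invertible, so the ranges agree. *)
Lemma line_of_uniq s c a b : line_of s -> isoline c -> a <> b ->
  s (c a) -> s (c b) -> s = range c.
Proof.
move=> /line_ofP[e ei ->] ci ab [u _ eu] [v _ ev].
have uv : u <> v.
  by move=> uv; apply: ab; apply: (isoline_inj ci); rewrite -eu -ev uv.
have := ei u v; rewrite eu ev ci => nab.
suff [r re] : exists r : R -> R, e = c \o r /\ exists q, cancel q r.
  case: re => -> [q qr]; apply/seteqP; split => [_ [t _ <-]|_ [t _ <-]].
    by exists (r t).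
  by exists (q t) => //=; rewrite qr.
have [sgn|sgn] : a - b = u - v \/ a - b = v - u.
- by move: nab; case: (ler0P (a - b)); case: (ler0P (u - v)) => *; lra.
- exists (fun t => a - u + t); split; last first.
    by exists (fun t => t - (a - u)) => t; ring.
  apply: (@isoline_uniq _ _ u v) => //; first exact: isoline_shift.
    by rewrite eu /= subrK.
  by rewrite ev /=; congr c; lra.
- exists (fun t => (a + u) - t); split; last first.
    by exists (fun t => (a + u) - t) => t; ring.
  apply: (@isoline_uniq _ _ u v) => //; first exact: isoline_flip.
    by rewrite eu /=; congr c; ring.
  by rewrite ev /=; congr c; lra.
Qed.

Lemma segment_ofE (x y : X) S : segment_of x y S -> segment x y = S.
Proof.
move=> hS; have [S' [_ Su]] := g1.1 x y.
rewrite /segment; case: xgetP => [T _ hT|/(_ S)//].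
by rewrite -(Su _ hT) (Su _ hS).
Qed.

Lemma segmentE c a b : isoline c -> a <= b ->
  segment (c a) (c b) = c @` `[a, b].
Proof. by move=> ci ab; apply: segment_ofE; exact: isoline_segment_of. Qed.

Lemma segmentEC c a b : isoline c -> a <= b ->
  segment (c b) (c a) = c @` `[a, b].
Proof.
move=> ci ab; have := @segmentE (fun t => c (b - t)) 0 (b - a).
rewrite subr0 opprB addrCA subrr addr0 => ->; last 2 first.
- exact: isoline_flip.
- by rewrite subr_ge0.
apply/seteqP; split => _ /= [t + <-]; rewrite in_itv /= => /andP[h1 h2].
  by exists (b - t) => //; rewrite in_itv /=; lra.
by exists (b - t); [rewrite in_itv /=; lra|congr c; ring].
Qed.

Lemma segmentxx (x : X) : segment x x = [set x].
Proof.
apply: segment_ofE; exists 0, (fun=> x); split => //.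
  split => // s t; rewrite /= !in_itv /= => hs ht; rewrite mdistxx.
  by have -> : s - t = 0; [lra|rewrite normr0].
apply/seteqP; split => [_ ->|_ [t _ <-]//].
by exists 0 => //=; rewrite in_itv /= lexx.
Qed.

Lemma segment_gline (x y : X) : x <> y ->
  segment x y = gline x y @` `[0, mdist x y].
Proof.
move=> xy; have [ci c1] := glineP xy.
by rewrite -{1}c1 -{1}(gline0 x y) segmentE ?mdist_ge0.
Qed.

Lemma segment_sym (x y : X) : segment x y = segment y x.
Proof.
have [->//|/eqP xy] := eqVneq x y.
have [ci c1] := glineP xy; have h := segmentEC ci (mdist_ge0 x y).
by rewrite gline0 c1 in h; rewrite h segment_gline.
Qed.

End geodesic_lines.

(** * Continuous dependence of geodesics on their end points *)

Section geodesic_continuity.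
Context {R : realType} {X : metricType R}.
Hypotheses (g1 : G1 X) (properX : proper_space X).

Lemma isoline_cont (c : R -> X) : isoline c -> continuous c.
Proof.
move=> ci t; apply/metricType_numDomainType.cvgrPdist_lt => e e0.
near=> s; rewrite ci; near: s.
by have /cvgrPdist_lt := @cvg_id _ (nbhs t); apply.
Unshelve. all: by end_near. Qed.

(** Along an ultrafilter, properness makes the lines converge at every fixed parameter. The limit is
    an isometric line with the values [a] at [0] and [b] at [mdist a b], hence it is [gline a b].
    The moving parameter [t i] costs at most [|u - t i|], lines being isometric. *)
Lemma gline_cvg (I : Type) (F : set_system I) {FF : Filter F}
    (x y : I -> X) (t : I -> R) (a b : X) (u : R) :
  x @ F --> a -> y @ F --> b -> t @ F --> u -> a <> b ->
  gline (x i) (y i) (t i) @[i --> F] --> gline a b u.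
Proof.
move=> xa yb tu ab; apply: cvg_ultra => G GU FG.
have {}xa : x @ G --> a by exact: cvg_finer FG xa.
have {}yb : y @ G --> b by exact: cvg_finer FG yb.
have {}tu : t @ G --> u by exact: cvg_finer FG tu.
have dab : mdist (x i) (y i) @[i --> G] --> mdist a b by exact: cvg_mdist.
have ab0 : 0 < mdist a b by rewrite mdist_gt0; exact/eqP.
have Gne : \forall i \near G, x i <> y i.
  near=> i => xyi.
  have : 0 < mdist (x i) (y i) by near: i; move: (0) ab0; apply: cvgr_gt; exact: dab.
  by rewrite xyi mdistxx ltxx.
have [c cP] : {c : R -> X & forall s, gline (x i) (y i) s @[i --> G] --> c s}.
  apply: (@choice _ _ (fun s l => gline (x i) (y i) s @[i --> G] --> l)) => s.
  have [l _ h] : exists2 p, [set z | mdist a z <= 1 + `|s|] p &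
      gline (x i) (y i) s @[i --> G] --> p.
    apply: ultra_compact_cvg; first exact: properX.
    near=> i; have xyi : x i <> y i by near: i.
    apply: (le_trans (metric_triangle _ (x i) _)); apply: lerD.
      near: i; apply: (metricType_numDomainType.cvgr_dist_le xa); exact: ltr01.
    by rewrite -{1}(gline0 (x i) (y i)) gline_iso// sub0r normrN.
  by exists l.
have ci : isoline c.
  move=> s s'; have h : mdist (gline (x i) (y i) s) (gline (x i) (y i) s') @[i --> G]
    --> mdist (c s) (c s') by exact: cvg_mdist.
  apply: (cvgr_uniq h). 
  apply: cvg_near_cst; near=> i; rewrite gline_iso//; by near: i.
have cE : gline a b = c.
  apply: (@isoline_uniq _ _ g1 _ _ 0 (mdist a b)) => //.
  - exact: gline_iso.
  - by move=> h; rewrite -h ltxx in ab0.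
  - rewrite gline0; apply: (cvg_uniq xa).
    by move: (cP 0); under eq_fun do rewrite gline0.
  - rewrite gline1//; apply: (cvg_uniq yb); apply: cvg_mdist0 (cP _) _.
    have : `|mdist a b - mdist (x i) (y i)| @[i --> G] --> (0 : R).
      rewrite -(normr0 R); apply: cvg_norm.
      rewrite -(subrr (mdist a b)).
      by apply: cvgB => //; exact: cvg_cst.
    apply: cvg_trans; apply: near_eq_cvg; near=> i.
    have xyi : x i <> y i by near: i.
    by rewrite -{3}(gline1 g1 xyi) gline_iso.
rewrite cE; apply: cvg_mdist0 (cP u) _.
have : `|u - t i| @[i --> G] --> (0 : R).
  rewrite -(normr0 R); apply: cvg_norm.
  by rewrite -(subrr u); apply: cvgB => //; exact: cvg_cst.
apply: cvg_trans; apply: near_eq_cvg; near=> i.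
by rewrite gline_iso//; near: i.
Unshelve. all: by end_near. Qed.

End geodesic_continuity.

(** * Open convex sets *)

Section open_convex.
Context {R : realType} {X : metricType R}.
Hypotheses (g1 : G1 X) (properX : proper_space X).
Variable (A : set X).
Hypotheses (openA : open A) (convA : geodesically_convex A).

Lemma convex_isoline (c : R -> X) a b t : isoline c -> A (c a) -> A (c b) ->
  a <= t <= b -> A (c t).
Proof.
move=> ci Aa Ab /andP[at_ tb]; apply: (convA Aa Ab).
rewrite (segmentE g1 ci) ?(le_trans at_ tb)//.
by exists t => //=; rewrite in_itv /= at_ tb.
Qed.

(* Points of [A] close to [c b] see, through [c t], points close to [c a]. *)
Lemma open_convex_lt (c : R -> X) a b t : isoline c -> A (c a) ->
  closure A (c b) -> a <= t < b -> A (c t).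
Proof.
move=> ci Aa Ab /andP[]; rewrite le_eqVlt => /predU1P[<-//|at_ tb].
have ctb : c b <> c t by move/(isoline_inj ci) => E; rewrite E ltxx in tb.
have h : gline q (c t) (b - a) @[q --> c b] --> gline (c b) (c t) (b - a).
  by apply: gline_cvg => //; exact: cvg_cst.
have h2 : mdist q (c t) @[q --> c b] --> mdist (c b) (c t).
  by apply: cvg_mdist => //; exact: cvg_cst.
have dbt : mdist (c b) (c t) = b - t by rewrite ci gtr0_norm ?subr_gt0.
have n1 : \forall q \near c b, A (gline q (c t) (b - a)).
  apply: h; rewrite (gline_gt g1 ci)//.
  have -> : b - (b - a) = a by ring.
  exact: open_nbhs_nbhs.
have n2 : \forall q \near c b, mdist q (c t) < b - a.
  by apply: (cvgr_lt _ h2); rewrite dbt; lra.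
have n3 : \forall q \near c b, 0 < mdist q (c t).
  by apply: (cvgr_gt _ h2); rewrite dbt; lra.
have [q [Aq [[q1 q2] q3]]] := Ab _ (filterI (filterI n1 n2) n3).
have qt : q <> c t by apply/eqP; rewrite -mdist_gt0.
have := @convex_isoline (gline q (c t)) 0 (b - a) (mdist q (c t)).
rewrite gline0 gline1//; apply => //; first exact: gline_iso.
by rewrite ltW//= ltW.
Qed.

Lemma open_convex_gt (c : R -> X) a b t : isoline c -> A (c a) ->
  closure A (c b) -> b < t <= a -> A (c t).
Proof.
move=> ci Aa Ab bta.
have := @open_convex_lt (fun u => c (0 - u)) (- a) (- b) (- t).
rewrite !sub0r !opprK; apply => //; first exact: isoline_flip.
by lra.
Qed.

Lemma frontierP (z : X) : frontier A z <-> closure A z /\ ~ A z.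
Proof. by rewrite /frontier ((interior_id A).1 openA). Qed.

Lemma frontier_sub_closure : frontier A `<=` closure A.
Proof. by move=> z []. Qed.

Lemma closed_frontier : closed (frontier A).
Proof.
rewrite /frontier setDE; apply: closedI; first exact: closed_closure.
by apply: open_closedC; exact: open_interior.
Qed.

Hypotheses (A0 : A !=set0) (bndA : metric_bounded A).

Lemma closure_bounded : exists M, forall x y, closure A x -> closure A y ->
  mdist x y <= M.
Proof.
have [M hM] := bndA; have [p Ap] := A0; exists (M + M) => x y Ax Ay.
have hp z : closure A z -> mdist p z <= M.
  have cB : closed [set z | mdist p z <= M].
    by apply: compact_closed; [exact: metric_hausdorff|exact: properX].
  move=> Az; apply: cB; apply: closure_subset Az => u Au /=; exact: hM.
apply: (le_trans (metric_triangle _ p _)).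
by rewrite lerD// ?hp// metric_sym hp.
Qed.

Lemma compact_closure : compact (closure A).
Proof.
have [M hM] := closure_bounded; have [p Ap] := A0.
apply: (subclosed_compact _ (@properX p M)); first exact: closed_closure.
by move=> z Az /=; apply: hM => //; exact: subset_closure.
Qed.

Lemma compact_frontier : compact (frontier A).
Proof.
apply: (subclosed_compact _ compact_closure); first exact: closed_frontier.
exact: frontier_sub_closure.
Qed.

(** The exit time is the supremum of the parameters at which the line is in the closure of [A].
    Openness keeps that point out of [A], and [open_convex_lt] puts everything before it into
    [A]. *)
Lemma exit_point (c : R -> X) b : isoline c -> A (c b) ->
  exists t, [/\ b < t, frontier A (c t), (forall s, b <= s < t -> A (c s)) &
    (forall s, t < s -> ~ closure A (c s))].
Proof.
move=> ci Ab; pose E := [set s | closure A (c s)].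
have Eb : E b by exact: subset_closure.
have [M hM] := closure_bounded.
have ubE : has_ubound E.
  exists (b + M) => s Es; have := hM _ _ Es Eb; rewrite ci => h.
  by have := ler_norm (s - b); lra.
have clE : closed E.
  apply: preimage_closed; last exact: closed_closure.
  by move=> x _; exact: isoline_cont.
have ET : E (sup E) by apply: clE; apply: closure_sup => //; exists b.
set T := sup E in ET *.
have Tup s : T < s -> ~ closure A (c s).
  by move=> Ts Es; have := ub_le_sup ubE Es; rewrite leNgt Ts.
have nAT : ~ A (c T).
  move=> AT; have cT : c s @[s --> T^'+] --> c T.
    by apply: cvg_at_right_filter; exact: isoline_cont.
  have /(@filter_ex _ _ (at_right_proper_filter T))[s [As Ts]] :
      \forall s \near T^'+, A (c s) /\ T < s.
    by apply: filterI; [apply: cT; exact: open_nbhs_nbhs|exact: nbhs_right_gt].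
  by apply: (Tup s) => //; exact: subset_closure.
have bT : b < T.
  rewrite lt_neqAle ub_le_sup// andbT; apply/eqP => h; apply: nAT.
  by rewrite -h.
exists T; split => //; first exact/frontierP.
by move=> s hs; exact: (@open_convex_lt c b T).
Qed.

Lemma chord (c : R -> X) b : isoline c -> frontier A (c 0) -> A (c b) -> 0 < b ->
  exists t, [/\ b < t, frontier A (c t), (forall s, 0 < s < t -> A (c s)),
    (forall s, s < 0 -> ~ closure A (c s)) &
    (forall s, t < s -> ~ closure A (c s))].
Proof.
move=> ci /frontierP[cl0 nA0] Ab b0; have [T [bT fT inT outT]] := exit_point ci Ab.
exists T; split => //.
- move=> s /andP[s0 sT]; have [sb|/ltW bs] := leP s b.
    by apply: (@open_convex_gt c b 0) => //; rewrite s0.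
  by apply: inT; rewrite bs.
- move=> s s0 cls; apply: nA0; apply: (@open_convex_gt c b s) => //.
  by rewrite s0 ltW.
Qed.

(** A line through a point of [A] meets the frontier exactly in the two ends of its chord, so the
    choice hidden in [second_point] has a single candidate. *)
Lemma second_point_chord (c : R -> X) b :
  isoline c -> frontier A (c 0) -> A (c b) -> 0 < b ->
  exists t, [/\ b < t, frontier A (c t), second_point A (c 0) (c b) = c t,
    (forall s, 0 < s < t -> A (c s)) &
    (forall s, s < 0 \/ t < s -> ~ closure A (c s))].
Proof.
move=> ci f0 Ab b0; have [t [bt ft h1 h2 h3]] := chord ci f0 Ab b0.
exists t; split => //; last by move=> s [/h2|/h3].
rewrite /second_point; case: xgetP => [z _ [fz zc [s [ls s0 sb sz]]]|]; last first.
  move/(_ (c t)) => /=; case; split => //.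
    by move/(isoline_inj ci) => h; lra.
  by exists (range c); split; [exact: isoline_line_of|exists 0|exists b|exists t].
have sE : s = range c.
  by apply: (line_of_uniq g1 ls ci _ s0 sb) => h; lra.
move: sz; rewrite sE => -[u _ cu]; rewrite -cu in fz zc *; congr c.
have [clu nAu] := (frontierP _).1 fz.
have [u0|u0|u0] := ltgtP u 0; first by case: (h2 _ u0).
  have [ut|ut|//] := ltgtP u t; last by case: (h3 _ ut).
  by case: nAu; apply: h1; rewrite u0.
by rewrite u0 in zc.
Qed.

Lemma second_point_eq (c : R -> X) a b u : isoline c -> a <> b ->
  frontier A (c a) -> frontier A (c b) -> A (c u) ->
  second_point A (c a) (c u) = c b.
Proof.
move=> ci; wlog ab : c a b u ci / a < b.
  move=> hw ab; have [h|h|//] := ltgtP a b; first by apply: hw => // /ab.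
  have := hw (fun t => c (0 - t)) (- a) (- b) (- u).
  rewrite !sub0r !opprK; apply; [exact: isoline_flip|by rewrite ltrN2|].
  by move/oppr_inj.
move=> _ fa fb Au; have [cla nAa] := (frontierP _).1 fa.
have [clb nAb] := (frontierP _).1 fb.
have ua : a < u.
  have [//|ua] := ltP a u; case: nAa.
  by apply: (open_convex_lt ci Au clb); rewrite ua ab.
have := @second_point_chord (fun t => c (a + t)) (u - a).
rewrite addr0 (addrC a (u - a)) subrK subr_gt0.
move=> /(_ (isoline_shift _ ci) fa Au ua)[t [h1 ft -> h2 h3]]; congr c.
have [h|h|//] := ltgtP (a + t) b.
  by case: (h3 (b - a)); [lra|rewrite addrC subrK].
by case: nAb; have := h2 (b - a); rewrite (addrC a) subrK; apply; lra.
Qed.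

Lemma second_pointP (th x : X) : frontier A th -> A x ->
  let z := second_point A th x in
  [/\ frontier A z, z <> th, mdist th x < mdist th z,
      z = gline th x (mdist th z) & x = gline th z (mdist th x)].
Proof.
move=> fth Ax; have [clth nAth] := (frontierP _).1 fth.
have thx : th <> x by move=> h; apply: nAth; rewrite h.
have d0 : 0 < mdist th x by rewrite mdist_gt0; exact/eqP.
have ci := gline_iso g1 thx.
have := @second_point_chord (gline th x) (mdist th x).
rewrite gline0 gline1// => /(_ ci fth Ax d0)[t [bt ft -> _ _]] /=.
have t0 : 0 < t by lra.
have dt : mdist th (gline th x t) = t.
  by rewrite -{1}(gline0 th x) ci sub0r normrN gtr0_norm.
split; rewrite ?dt//.
  by rewrite -{2}(gline0 th x) => /(isoline_inj ci) h; rewrite h ltxx in t0.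
have := gline_lt g1 ci t0; rewrite gline0 => ->.
by rewrite add0r gline1.
Qed.

(** A limit of second points exists in the compact frontier and lies on the limit line. Its distance
    from [a] is at least [mdist a b > 0], so it cannot have collapsed to [a] and must be the other
    end of the chord. *)
Lemma second_point_cvg (I : Type) (F : set_system I) {FF : Filter F}
    (th x : I -> X) (a b : X) :
  (\forall i \near F, frontier A (th i)) -> (\forall i \near F, A (x i)) ->
  frontier A a -> A b -> th @ F --> a -> x @ F --> b ->
  second_point A (th i) (x i) @[i --> F] --> second_point A a b.
Proof.
move=> Fth Fx fa Ab tha xb; apply: cvg_ultra => G GU FG.
have {}tha : th @ G --> a by exact: cvg_finer FG tha.
have {}xb : x @ G --> b by exact: cvg_finer FG xb.
have {}Fth := FG _ Fth; have {}Fx := FG _ Fx.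
have [cla nAa] := (frontierP _).1 fa.
have ab : a <> b by move=> h; apply: nAa; rewrite h.
have [z fz zP] : exists2 p, frontier A p &
    second_point A (th i) (x i) @[i --> G] --> p.
  apply: ultra_compact_cvg; first exact: compact_frontier.
  near=> i; have h1 : frontier A (th i) by near: i.
  have h2 : A (x i) by near: i.
  by have [] := second_pointP h1 h2.
suff -> : second_point A a b = z by [].
have dz : mdist (th i) (second_point A (th i) (x i)) @[i --> G] --> mdist a z.
  exact: cvg_mdist.
have dab : mdist (th i) (x i) @[i --> G] --> mdist a b by exact: cvg_mdist.
have zE : z = gline a b (mdist a z).
  apply: (cvg_uniq zP).
  have : gline (th i) (x i) (mdist (th i) (second_point A (th i) (x i)))
      @[i --> G] --> gline a b (mdist a z) by exact: gline_cvg.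
  apply: cvg_trans; apply: near_eq_cvg; near=> i.
  have h1 : frontier A (th i) by near: i.
  have h2 : A (x i) by near: i.
  by have [_ _ _ <- _] := second_pointP h1 h2.
have dle : mdist a b <= mdist a z.
  apply: (ler_cvg_lim dab dz); near=> i.
  have h1 : frontier A (th i) by near: i.
  have h2 : A (x i) by near: i.
  by have [_ _ /ltW] := second_pointP h1 h2.
have d0 : 0 < mdist a b by rewrite mdist_gt0; exact/eqP.
have ci := gline_iso g1 ab.
have := @second_point_eq (gline a b) 0 (mdist a z) (mdist a b) ci.
rewrite gline0 -zE gline1//; apply => //.
by move=> h; rewrite -h leNgt d0 in dle.
Unshelve. all: by end_near. Qed.

End open_convex.

(** * Closed curves *)

Section closed_curve.
Context {R : realType} {X : metricType R} (C : set X) (g : R -> X).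
Hypothesis hg : clockwise_parametrization C g.

Lemma curve_cont : continuous g.
Proof. by case: hg. Qed.

Lemma curve_in t : C (g t).
Proof. by case: hg => _ _ _ <-; exists t. Qed.

Lemma curve_period t (z : int) : g (t + z%:~R) = g t.
Proof.
have per s : g (s + 1) = g s by case: hg.
have pern s (n : nat) : g (s + n%:R) = g s.
  by elim: n => [|n ih]; rewrite ?addr0// -natr1 addrA per.
case: z => n; first exact: pern.
rewrite NegzE mulrNz -[in RHS](subrK n.+1%:R t) pern.
by congr (g (_ - _)).
Qed.

Lemma curve_periodN t (z : int) : g (t - z%:~R) = g t.
Proof. by rewrite -mulrNz curve_period. Qed.

Lemma curve_inj s t : g s = g t -> `|s - t| < 1 -> s = t.
Proof.
move=> gst st; have fl (x : R) : 0 <= x - (Num.floor x)%:~R < 1.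
  by have := floor_itv x; rewrite intrD; lra.
case: hg => _ _ inj _.
have E : s - (Num.floor s)%:~R = t - (Num.floor t)%:~R.
  apply: inj; rewrite ?in_itv/= ?fl//.
  by rewrite !curve_periodN.
have E2 : s - t = (Num.floor s - Num.floor t)%:~R by rewrite intrB; lra.
move: st; rewrite E2 -intr_norm ltrz1 => h.
have h0 : Num.floor s - Num.floor t = 0.
  by apply/eqP; rewrite -normr_le0 -ltzD1 add0r.
by apply/eqP; rewrite -subr_eq0 E2 h0.
Qed.

Lemma curve_lift b a : C a -> exists2 t, b <= t < b + 1 & g t = a.
Proof.
case: hg => _ _ _ <- [u _ <-]; exists (u - (Num.floor (u - b))%:~R).
  by have := floor_itv (u - b); rewrite intrD; lra.
by rewrite curve_periodN.
Qed.

Lemma baseP th : C th -> g (base g th) = th.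
Proof.
move=> /(curve_lift 0)[t _ gt]; rewrite /base.
by case: xgetP => [s _|/(_ t)].
Qed.

Lemma posE th t : C th -> base g th < t < base g th + 1 -> pos g th (g t) = t.
Proof.
move=> Cth ht; rewrite /pos; case: xgetP => [s _ [hs gs]|]; last first.
  by move=> /(_ t); case.
by apply: curve_inj => //; rewrite ltr_norml; lra.
Qed.

Lemma posP th a : C th -> C a -> a <> th ->
  base g th < pos g th a < base g th + 1 /\ g (pos g th a) = a.
Proof.
move=> Cth Ca ath; have [t ht gt] := curve_lift (base g th) Ca.
have ht' : base g th < t < base g th + 1.
  move: ht; rewrite le_eqVlt => /andP[/predU1P[h|->//]].
  by case: ath; rewrite -gt -h baseP.
by rewrite -gt posE.
Qed.

Lemma curve_neq_base th t : C th -> base g th < t < base g th + 1 -> g t <> th.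
Proof.
move=> Cth ht; rewrite -(baseP Cth) => /curve_inj h.
suff : t = base g th by lra.
by apply: h; rewrite ltr_norml; lra.
Qed.

(** A limit of the positions lies in the closed interval of length one and is mapped to [a]. Both
    ends of that interval are mapped to [th], so they are excluded, and inside it the parameter of
    [a] is unique. *)
Lemma pos_cvg (I : Type) (F : set_system I) {FF : Filter F} (x : I -> X) th a :
  C th -> C a -> a <> th -> (\forall i \near F, C (x i)) -> x @ F --> a ->
  pos g th (x i) @[i --> F] --> pos g th a.
Proof.
move=> Cth Ca ath FC xa; apply: cvg_ultra => G GU FG.
have {}xa : x @ G --> a by exact: cvg_finer FG xa.
have {}FC := FG _ FC.
have Gne : \forall i \near G, x i <> th.
  have d0 : 0 < mdist a th by rewrite mdist_gt0; exact/eqP.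
  have : \forall i \near G, mdist a (x i) < mdist a th.
    by apply: (metricType_numDomainType.cvgr_dist_lt xa).
  by apply: filterS => i + E; rewrite E ltxx.
have [t] : exists2 p, `[base g th, base g th + 1]%classic p &
    pos g th (x i) @[i --> G] --> p.
  apply: ultra_compact_cvg; first exact: segment_compact.
  near=> i; have h1 : C (x i) by near: i.
  have h2 : x i <> th by near: i.
  by have [h _] := posP Cth h1 h2; rewrite /= in_itv /=; lra.
rewrite /= in_itv /= => ht post.
have gt : g t = a.
  apply: (@cvg_uniq _ _ _ G _ (fun i => g (pos g th (x i)))).
    exact: (cvg_comp _ _ post (@curve_cont t)).
  apply: cvg_trans xa; apply: near_eq_cvg; near=> i.
  have h1 : C (x i) by near: i.
  have h2 : x i <> th by near: i.
  by have [_ ->] := posP Cth h1 h2.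
rewrite -gt posE//.
have := baseP Cth; have := curve_period (base g th) 1; rewrite -gt in ath.
move=> h1 h2.
have [n1 n2] : base g th <> t /\ base g th + 1 <> t.
  by split => h; apply: ath; rewrite -h ?h1 h2.
by rewrite !lt_neqAle !(introF eqP n1)/= eq_sym (introF eqP n2)/=.
Unshelve. all: by end_near. Qed.

(* The base point moves, so positions are compared after subtracting it. *)
Lemma pos_between_lim (I : Type) (G : set_system I) {GU : UltraFilter G}
    (th x y z : I -> X) (t q r : X) :
  (forall i, C (th i)) -> (\forall i \near G, [/\ C (x i), C (y i) & C (z i)]) ->
  (\forall i \near G, [/\ x i <> th i, y i <> th i & z i <> th i]) ->
  th @ G --> t -> x @ G --> q -> y @ G --> r -> z @ G --> q ->
  t <> q ->
  (\forall i \near G, pos g (th i) (x i) <= pos g (th i) (y i)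
                      <= pos g (th i) (z i)) -> r = q.
Proof.
move=> Cth GC Gne tht xq yr zq tq Gbet.
(* [base] picks an arbitrary lift of [th i]; its integer part is removed so that the lifts stay in a
   compact interval. *)
pose fl i := (Num.floor (base g (th i)))%:~R : R.
pose b i := base g (th i) - fl i.
have [beta _ bb] : exists2 p : R, `[0, 1]%classic p & b @ G --> p.
  apply: ultra_compact_cvg; first exact: segment_compact.
  apply: filterE => i; have := floor_itv (base g (th i)).
  by rewrite intrD /b /fl /= in_itv /=; lra.
have shift i s : g (s - fl i) = g s by rewrite /fl curve_periodN.
have gbeta : g beta = t.
  apply: (@cvg_uniq _ _ _ G _ (fun i => g (b i))).
    exact: (cvg_comp _ _ bb (@curve_cont beta)).
  apply: cvg_trans tht; apply: near_eq_cvg; apply: filterE => i.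
  by rewrite /b shift baseP.
have key (x' : I -> X) (l : X) : (\forall i \near G, C (x' i)) ->
    (\forall i \near G, x' i <> th i) -> x' @ G --> l ->
    exists2 u : R, 0 <= u <= 1 /\ g (beta + u) = l &
      pos g (th i) (x' i) - base g (th i) @[i --> G] --> u.
  move=> Cx nx xl; have [u] : exists2 p : R, `[0, 1]%classic p &
      pos g (th i) (x' i) - base g (th i) @[i --> G] --> p.
    apply: ultra_compact_cvg; first exact: segment_compact.
    near=> i; have h1 : C (x' i) by near: i.
    have h2 : x' i <> th i by near: i.
    by have [h _] := posP (Cth i) h1 h2; rewrite /= in_itv /=; lra.
  rewrite /= in_itv /= => u01 hu; exists u => //; split => //.
  pose k i := b i + (pos g (th i) (x' i) - base g (th i)).
  have hk : k @ G --> beta + u by exact: cvgD.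
  apply: (@cvg_uniq _ _ _ G _ (fun i => g (k i))).
    exact: (cvg_comp _ _ hk (@curve_cont (beta + u))).
  apply: cvg_trans xl; apply: near_eq_cvg; near=> i.
  have h1 : C (x' i) by near: i.
  have h2 : x' i <> th i by near: i.
  have [_ {1}<-] := posP (Cth i) h1 h2; rewrite -(shift i); congr g.
  by rewrite /k /b; ring.
have cmp (x' y' : I -> X) (u v : R) :
    pos g (th i) (x' i) - base g (th i) @[i --> G] --> u ->
    pos g (th i) (y' i) - base g (th i) @[i --> G] --> v ->
    (\forall i \near G, pos g (th i) (x' i) <= pos g (th i) (y' i)) -> u <= v.
  move=> hu hv hle; apply: (ler_cvg_lim hu hv).
  by apply: filterS hle => i; rewrite lerD2r.
have [|||u [u01 gu] hu] := key x q => //.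
- by apply: filterS GC => i [].
- by apply: filterS Gne => i [].
have [|||v [v01 gv] hv] := key y r => //.
- by apply: filterS GC => i [].
- by apply: filterS Gne => i [].
have [|||w [w01 gw] hw] := key z q => //.
- by apply: filterS GC => i [].
- by apply: filterS Gne => i [].
have uv : u <= v by apply: (cmp _ _ _ _ hu hv); apply: filterS Gbet => i /andP[].
have vw : v <= w by apply: (cmp _ _ _ _ hv hw); apply: filterS Gbet => i /andP[].
have in01 s : 0 <= s <= 1 -> g (beta + s) = q -> 0 < s < 1.
  move=> s01 gs; have n0 : s <> 0 by move=> h; apply: tq; rewrite -gbeta -gs h addr0.
  have n1 : s <> 1.
    by move=> h; apply: tq; rewrite -gbeta -gs h; exact/esym/(curve_period beta 1).
  by move: s01; rewrite !le_eqVlt => /andP[/predU1P[/esym//|->] /predU1P[//|->]].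
have := in01 _ u01 gu; have := in01 _ w01 gw => hw1 hu1.
have uw : beta + u = beta + w.
  by apply: curve_inj; [rewrite gu gw|rewrite ltr_norml; lra].
have -> : r = g (beta + v) by [].
by rewrite -gu; congr g; lra.
Unshelve. all: by end_near. Qed.

End closed_curve.

(** * Piecewise geodesic curves *)

Section segments.
Context {R : realType} {X : metricType R}.
Hypotheses (g1 : G1 X).

Lemma segmentP (x y z : X) : segment x y z ->
  exists2 u, 0 <= u <= mdist x y & gline x y u = z.
Proof.
have [->|/eqP xy] := eqVneq x y.
  by rewrite segmentxx// => ->; exists 0; rewrite ?gline0 ?mdistxx ?lexx.
by rewrite segment_gline// => -[u]; rewrite /= in_itv /=; exists u.
Qed.

Lemma segment_closed (x y : X) : closed (segment x y).
Proof.
have [->|/eqP xy] := eqVneq x y.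
  rewrite segmentxx//; apply: compact_closed; last exact: compact_set1.
  exact: metric_hausdorff.
rewrite segment_gline//; apply: compact_closed; first exact: metric_hausdorff.
apply: continuous_compact; last exact: segment_compact.
by apply: continuous_subspaceT; apply: isoline_cont; exact: gline_iso.
Qed.

Lemma segment_convex (x y a b : X) : segment x y a -> segment x y b ->
  segment a b `<=` segment x y.
Proof.
have [->|/eqP xy] := eqVneq x y.
  by rewrite segmentxx// => -> ->; rewrite segmentxx.
move=> /segmentP[u hu <-] /segmentP[v hv <-].
have ci := gline_iso g1 xy; rewrite (segment_gline g1 xy).
have [uv|/ltW uv] := leP u v; [rewrite segmentE//|rewrite segmentEC//];
  move=> _ [t ht <-]; exists t => //; move: ht; rewrite /= !in_itv /=; lra.
Qed.

Lemma mdist_segment (x y z : X) : segment x y z -> mdist x z <= mdist x y.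
Proof.
have [->|/eqP xy] := eqVneq x y; first by rewrite segmentxx// => ->.
move=> /segmentP[u hu <-]; rewrite -{1}(gline0 x y) gline_iso// sub0r normrN.
by rewrite ger0_norm; lra.
Qed.

Lemma segment_endl (x y : X) : segment x y x.
Proof.
have [->|/eqP xy] := eqVneq x y; first by rewrite segmentxx.
rewrite segment_gline//; exists 0; last by rewrite gline0.
by rewrite /= in_itv /= lexx mdist_ge0.
Qed.

End segments.

(** * Local geodesics in a closed polygonal curve *)

Section local_geodesic.
Context {R : realType} {X : metricType R}.
Hypotheses (g1 : G1 X).
Variables (C : set X) (g : R -> X) (sides : seq (X * X)).
Hypothesis hg : clockwise_parametrization C g.
Hypothesis hC : C = \bigcup_(e in [set` sides]) segment e.1 e.2.

(** The curve runs along a geodesic without turning back, at whatever speed. *)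
Definition additive_curve a b := forall s r u, a <= s -> s <= r -> r <= u ->
  u <= b -> mdist (g s) (g u) = mdist (g s) (g r) + mdist (g r) (g u).

(* The segment from [g t] to [g t'] avoids the antipode of [t], so it lifts to a
   path of parameters from [t] to [t'], which runs through everything between. *)
Lemma curve_sub_segment t t' s : `|t - t'| < 1 / 2 ->
  segment (g t) (g t') `<=` C -> ~ segment (g t) (g t') (g (t + 1 / 2)) ->
  Num.min t t' <= s <= Num.max t t' -> segment (g t) (g t') (g s).
Proof.
move=> tt' sC nq hs; set q := g (t + 1 / 2) in nq.
have [tE|/eqP ntt'] := eqVneq t t'.
  move: hs; rewrite -tE minxx maxxx -eq_le => /eqP <-.
  exact: segment_endl.
have Cq : C q := curve_in hg _.
have [n bE] : exists n : int, base g q = t + 1 / 2 + n%:~R.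
  pose b := base g q; pose n := Num.floor (b - (t + 1 / 2)); exists n.
  have hn := floor_itv (b - (t + 1 / 2)).
  suff : b - n%:~R = t + 1 / 2 by rewrite /b; lra.
  apply: (curve_inj hg); first by rewrite (curve_periodN hg) /b (baseP hg).
  by move: hn; rewrite intrD -/n ltr_norml; lra.
(* Cutting the circle at the antipode [q] puts all parameters within [1 / 2] of [t] inside one
   fundamental interval, where the position is the parameter up to the fixed integer [n + 1]. *)
have posq u : `|t - u| < 1 / 2 -> pos g q (g u) = u + (n + 1)%:~R.
  move=> hu; rewrite -(curve_period hg u (n + 1)) (posE hg)// bE intrD.
  by move: hu; rewrite ltr_norml; lra.
have gtt' : g t <> g t'.
  by move/(curve_inj hg) => h; apply: ntt'; apply: h; lra.
have ci := gline_iso g1 gtt'; pose c := gline (g t) (g t'); pose D := mdist (g t) (g t').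
have segc v : 0 <= v <= D -> segment (g t) (g t') (c v).
  by move=> hv; rewrite segment_gline//; exists v; rewrite //= in_itv.
have cont : {within `[0, D], continuous (fun v => pos g q (c v))}.
  apply/subspace_continuousP => v; rewrite /= in_itv /= => hv.
  apply: (pos_cvg hg) => //; first exact/sC/segc.
  - by move=> h; apply: nq; rewrite -h; exact: segc.
  - rewrite near_withinE; near=> u => hu; apply/sC/segc.
    by move: hu; rewrite /= in_itv.
  - by apply: cvg_within_filter; apply: (isoline_cont ci).
have [] := @IVT _ (fun v => pos g q (c v)) 0 D (s + (n + 1)%:~R) _ cont.
- exact: mdist_ge0.
- rewrite /c gline0 gline1// (posq t')// (posq t) ?subrr ?normr0 ?divr_gt0//.
  by rewrite -addr_minl -addr_maxl !lerD2r.
move=> v; rewrite in_itv /= => hv E.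
have Ccv : C (c v) by exact/sC/segc.
have ncv : c v <> q by move=> h; apply: nq; rewrite -h; exact: segc.
suff -> : g s = c v by exact: segc.
by rewrite -(posP hg Cq Ccv ncv).2 E (curve_period hg).
Unshelve. all: by end_near. Qed.

(** The subarc stays on the segment, so [g s] is determined by its distance [f s] from [g t]. This
    [f] is continuous and injective, hence monotone, and distances on the subarc are the differences
    [|f s - f u|]. *)
Lemma additive_curve_segment t t' : `|t - t'| < 1 / 2 ->
  segment (g t) (g t') `<=` C -> ~ segment (g t) (g t') (g (t + 1 / 2)) ->
  additive_curve (Num.min t t') (Num.max t t').
Proof.
move=> tt' sC nq; set a := Num.min t t'; set b := Num.max t t'.
have ab : a <= b /\ b - a < 1.
  move: tt'; rewrite /a /b ltr_norml; case: (leP t t') => h /andP[h1 h2]; split; lra.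
have inS s : a <= s <= b -> segment (g t) (g t') (g s).
  exact: curve_sub_segment.
have [gtt'|/eqP gtt'] := eqVneq (g t) (g t').
  move=> s r u h1 h2 h3 h4.
  have E v : a <= v <= b -> g v = g t.
    by move=> /inS; rewrite -gtt' segmentxx.
  by rewrite !E ?mdistxx ?addr0//; lra.
pose f s := mdist (g t) (g s); have ci := gline_iso g1 gtt'.
have gE s : a <= s <= b -> g s = gline (g t) (g t') (f s).
  move=> /inS /(segmentP g1)[v hv vE].
  by rewrite /f -vE mdist_gline// ger0_norm//; lra.
have dE s u : a <= s <= b -> a <= u <= b -> mdist (g s) (g u) = `|f s - f u|.
  by move=> hs hu; rewrite [in LHS]gE// [in LHS](gE u)// ci.
have fc : {within `[a, b], continuous f}.
  apply: continuous_subspaceT => s; apply: cvg_mdist; first exact: cvg_cst.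
  exact: (curve_cont hg).
have fi : {in `[a, b] &, injective f}.
  move=> s u; rewrite !in_itv /= => hs hu fsu.
  apply: (curve_inj hg); first by rewrite gE// (gE u)// fsu.
  by rewrite ltr_norml; lra.
move=> s r u h1 h2 h3 h4; rewrite !dE; try lra.
have [->|sr] := eqVneq s r; first by rewrite subrr normr0 add0r.
have [->|ru] := eqVneq r u; first by rewrite subrr normr0 addr0.
have sr' : s < r by rewrite lt_neqAle sr.
have ru' : r < u by rewrite lt_neqAle ru.
have [] := continuous_inj_between fc fi h1 sr' ru' h4.
- by move=> h; rewrite !ltr0_norm; lra.
- by move=> h; rewrite !gtr0_norm; lra.
Qed.

(** An ultrafilter converging to [t] selects one of the finitely many sides, and that side contains
    [g t] because it is closed. For [s] close to [t], the segment from [g t] to [g s] stays in this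
    side by convexity and is too short to reach the antipode of [t]. *)
Lemma curve_side_near (F : set_system R) {FF : ProperFilter F} (t : R)
    (A : set R) : F --> t -> F A ->
  exists2 t', A t' & additive_curve (Num.min t t') (Num.max t t').
Proof.
move=> Ft FA; have [G [GU FG]] := ultraFilterLemma FF.
have Gt : id @ G --> t by apply: cvg_finer FG _; exact: Ft.
have Ggt : g @ G --> g t by exact: (cvg_comp _ _ Gt (@curve_cont _ _ _ _ hg t)).
have [e es Ge] : exists2 e, e \in sides & \forall s \near G, segment e.1 e.2 (g s).
  have : \forall s \near G, exists2 e, e \in sides & segment e.1 e.2 (g s).
    by apply: filterE => s; have := curve_in hg s; rewrite hC => -[e he hs]; exists e.
  elim: (sides) => [|e l ih] h.
    by have /filter_ex[s [? ]] := h.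
  have [h1|h1] := in_ultra_setVsetC [set s | segment e.1 e.2 (g s)] GU.
    by exists e => //; rewrite mem_head.
  have [|e' e'l h2] := ih; last by exists e' => //; rewrite inE e'l orbT.
  apply: filterS (filterI h h1) => s [[e']].
  by rewrite inE => /predU1P[-> //|e'l h2 _]; exists e'.
have egt : segment e.1 e.2 (g t).
  by apply: (closed_cvgW _ Ge Ggt); exact: segment_closed.
have ntq : g t <> g (t + 1 / 2).
  move/(curve_inj hg) => h; suff : t = t + 1 / 2 by lra.
  by apply: h; rewrite ltr_norml; lra.
have d0 : 0 < mdist (g t) (g (t + 1 / 2)) by rewrite mdist_gt0; exact/eqP.
have Gd : \forall s \near G, mdist (g t) (g s) < mdist (g t) (g (t + 1 / 2)).
  exact: (metricType_numDomainType.cvgr_dist_lt Ggt).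
have Gs : \forall s \near G, `|t - s| < 1 / 2.
  by move/cvgrPdist_lt : Gt; apply; lra.
have /filter_ex[s [[[h1 h2] h3] h4]] : \forall s \near G,
    ((mdist (g t) (g s) < mdist (g t) (g (t + 1 / 2)) /\ `|t - s| < 1 / 2) /\
      segment e.1 e.2 (g s)) /\ A s.
  by do 3?apply: filterI => //; exact: FG.
exists s => //; apply: additive_curve_segment => //.
  apply: (subset_trans (segment_convex g1 egt h3)).
  by rewrite hC => z hz; exists e.
by move=> /(mdist_segment g1); rewrite leNgt h1.
Qed.

Lemma additive_curve_right t b : t < b ->
  exists2 t', t < t' < b & additive_curve t t'.
Proof.
move=> tb; have [||t' /= h] := @curve_side_near t^'+ _ t [set s | t < s < b].
- exact: cvg_at_right_filter cvg_id.
- near=> s; rewrite /=; apply/andP; split; near: s.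
    exact: nbhs_right_gt.
  exact: nbhs_right_lt.
move=> ad; exists t' => //; move: ad.
by rewrite min_l ?max_r//; lra.
Unshelve. all: by end_near. Qed.

Lemma additive_curve_left t a : a < t ->
  exists2 t', a < t' < t & additive_curve t' t.
Proof.
move=> tb; have [||t' /= h] := @curve_side_near t^'- _ t [set s | a < s < t].
- exact: cvg_at_left_filter cvg_id.
- near=> s; rewrite /=; apply/andP; split; near: s.
    exact: nbhs_left_gt.
  exact: nbhs_left_lt.
move=> ad; exists t' => //; move: ad.
by rewrite min_r ?max_l//; lra.
Unshelve. all: by end_near. Qed.

End local_geodesic.

(** * Length of curves *)

Section length_of_curve.
Context {R : realType} {X : metricType R} (g : R -> X).

Fixpoint polyline_length (a : R) (s : seq R) : R :=
  if s is x :: s' then mdist (g a) (g x) + polyline_length x s' else 0.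

Lemma curve_lengthE a b : curve_length a b g =
  sup [set l | exists2 s, itv_partition a b s & l = polyline_length a s].
Proof.
congr (sup _); suff h s : \sum_(0 <= n < size s)
    mdist (g (nth b (a :: s) n)) (g (nth b s n)) = polyline_length a s.
  by apply/seteqP; split => _ [s hs ->]; exists s; rewrite ?h.
elim: s a => [|x s ih] a /=; first by rewrite big_nil.
by rewrite big_nat_recl//= -ih.
Qed.

Lemma polyline_length_cat a s1 s2 : polyline_length a (s1 ++ s2) =
  polyline_length a s1 + polyline_length (last a s1) s2.
Proof. by elim: s1 a => [|x s ih] a /=; rewrite ?add0r// ih addrA. Qed.

Lemma polyline_split a b c s : itv_partition a b s -> a <= c <= b ->
  exists s1 s2, [/\ itv_partition a c s1, itv_partition c b s2 &
    polyline_length a s <= polyline_length a s1 + polyline_length c s2].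
Proof.
elim: s a => [|x s ih] a.
  move=> /itv_partition_nil -> h; exists [::], [::].
  have -> : c = b by lra.
  by split => //=; rewrite ?addr0.
move=> ps /andP[]; rewrite le_eqVlt => /predU1P[<- _|ac cb].
  by exists [::], (x :: s); split => //; rewrite ?add0r.
have [xc|cx] := leP x c.
  have [|s1 [s2 [h1 h2 h3]]] := ih x (itv_partition_cons ps).
    by rewrite xc.
  exists (x :: s1), s2; split => //=; last by rewrite -addrA lerD2l.
  by case: ps => /= /andP[ax _] _; case: h1 => h1 h1'; split => //=; rewrite ax.
exists [:: c], (x :: s); split => //; first exact: itv_partition1.
  by case: ps => /= /andP[_ h] h'; split => //=; rewrite cx.
by rewrite /= addr0 addrA lerD2r metric_triangle.
Qed.

Lemma polyline_additive a b s : additive_curve g a b -> itv_partition a b s ->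
  polyline_length a s = mdist (g a) (g b).
Proof.
elim: s a => [|x s ih] a ad ps; first by rewrite (itv_partition_nil ps) mdistxx.
have xb := itv_partition_le (itv_partition_cons ps).
have ax : a < x by case: ps => /= /andP[].
rewrite /= ih; last exact: itv_partition_cons ps.
  by rewrite -ad// ltW.
by move=> u v w h; apply: ad; rewrite (le_trans (ltW ax)).
Qed.

Lemma itv_partition_ex (a b : R) : a <= b -> exists s, itv_partition a b s.
Proof.
rewrite le_eqVlt => /predU1P[->|ab]; first by exists [::]; split.
by exists [:: b]; exact: itv_partition1.
Qed.

Definition rectifiable a b :=
  exists M, forall s, itv_partition a b s -> polyline_length a s <= M.

Lemma rectifiable_cat a b c : a <= c -> c <= b ->
  rectifiable a c -> rectifiable c b -> rectifiable a b.
Proof.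
move=> ac cb [M hM] [N hN]; exists (M + N) => s hs.
have [|s1 [s2 [h1 h2 h3]]] := polyline_split hs (c := c); first by rewrite ac.
by apply: (le_trans h3); rewrite lerD// ?hM ?hN.
Qed.

Lemma rectifiable_additive a b : additive_curve g a b -> rectifiable a b.
Proof.
by move=> ad; exists (mdist (g a) (g b)) => s hs; rewrite (polyline_additive ad hs).
Qed.

Hypothesis adr : forall t b, t < b -> exists2 t', t < t' < b & additive_curve g t t'.
Hypothesis adl : forall t a, a < t -> exists2 t', a < t' < t & additive_curve g t' t.

(** Induction along the interval: at the supremum of the good parameters, the geodesic piece on the
    left shows that the supremum is good, and the piece on the right would push it further unless it
    is [b]. *)
Lemma locally_additive_rectifiable a b : a <= b -> rectifiable a b.
Proof.
rewrite le_eqVlt => /predU1P[->|ab].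
  by exists 0 => s /itv_partitionxx ->.
pose E := [set t | a <= t <= b /\ rectifiable a t].
have Ea : E a by split; [rewrite lexx ltW|exists 0 => s /itv_partitionxx ->].
have ubE : has_ubound E by exists b => t [/andP[]].
set T := sup E.
have aT : a <= T by exact: ub_le_sup.
have Tb : T <= b by apply: ge_sup; [exists a|move=> t [/andP[]]].
have rT : rectifiable a T.
  move: aT; rewrite le_eqVlt => /predU1P[<-|aT]; first by case: Ea.
  have [t' /andP[at' t'T] ad] := adl aT.
  have [|u [/andP[au ub] ru] t'u] := @sup_adherent _ E (T - t') _ (conj (ex_intro _ a Ea) ubE).
    by rewrite subr_gt0.
  have uT : u <= T by apply: ub_le_sup => //; split => //; rewrite au.
  apply: (rectifiable_cat au uT ru); apply: rectifiable_additive.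
  move=> r s v h; apply: ad; rewrite (le_trans _ h)//.
  by move: t'u; rewrite -/T; lra.
move: Tb; rewrite le_eqVlt => /predU1P[<-//|Tb].
have [t' /andP[Tt' t'b] ad] := adr Tb.
have : E t'.
  split; first by rewrite (le_trans aT (ltW Tt')) ltW.
  by apply: (rectifiable_cat aT (ltW Tt') rT); exact: rectifiable_additive.
by move=> /(ub_le_sup ubE); rewrite leNgt Tt'.
Qed.

Let L a b := curve_length a b g.

Lemma has_sup_polyline a b : a <= b ->
  has_sup [set l | exists2 s, itv_partition a b s & l = polyline_length a s].
Proof.
move=> ab; split.
  by have [s hs] := itv_partition_ex ab; exists (polyline_length a s), s.
by have [M hM] := locally_additive_rectifiable ab; exists M => _ [s hs ->]; exact: hM.
Qed.

Lemma polyline_le_length a b s : itv_partition a b s -> polyline_length a s <= L a b.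
Proof.
move=> hs; rewrite /L curve_lengthE; apply: ub_le_sup; last by exists s.
exact: (has_sup_polyline (itv_partition_le hs)).2.
Qed.

Lemma curve_length_le a b M : a <= b ->
  (forall s, itv_partition a b s -> polyline_length a s <= M) -> L a b <= M.
Proof.
move=> ab h; rewrite /L curve_lengthE; apply: ge_sup.
  exact: (has_sup_polyline ab).1.
by move=> _ [s hs ->]; exact: h.
Qed.

Lemma curve_lengthD a b c : a <= c -> c <= b -> L a b = L a c + L c b.
Proof.
move=> ac cb; apply/eqP; rewrite eq_le; apply/andP; split.
  apply: curve_length_le; first exact: le_trans ac cb.
  move=> s hs; have [|s1 [s2 [h1 h2 h3]]] := polyline_split hs (c := c).
    by rewrite ac.
  by apply: (le_trans h3); rewrite lerD// polyline_le_length.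
rewrite -lerBrDr; apply: curve_length_le => // s1 h1.
rewrite lerBrDr -lerBrDl; apply: curve_length_le => // s2 h2.
rewrite lerBrDl; have := polyline_le_length (itv_partition_cat h1 h2).
by rewrite polyline_length_cat; case: (h1) => _ /eqP ->.
Qed.

Lemma curve_length_ge a b : a <= b -> mdist (g a) (g b) <= L a b.
Proof.
rewrite le_eqVlt => /predU1P[->|ab].
  rewrite mdistxx; have := @polyline_le_length b b [::]; apply.
  by split.
by have := polyline_le_length (itv_partition1 ab); rewrite /= addr0.
Qed.

Lemma curve_length_additive a b : a <= b -> additive_curve g a b ->
  L a b = mdist (g a) (g b).
Proof.
move=> ab ad; apply/eqP; rewrite eq_le curve_length_ge// andbT.
by apply: curve_length_le => // s hs; rewrite (polyline_additive ad hs).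
Qed.

Hypothesis gcont : continuous g.

(** On each side of [t] a short piece of the curve is geodesic, so its length is a distance, which
    continuity makes at most [e / 2]. *)
Lemma curve_length_small t e : 0 < e -> exists2 d, 0 < d &
  forall u v, t - d <= u -> u <= v -> v <= t + d -> L u v <= e.
Proof.
move=> e0.
have n1 : \forall s \near t, mdist (g t) (g s) < e / 2.
  by apply: (metricType_numDomainType.cvgr_dist_lt (gcont (x:=t))); lra.
have [d1 /= d10 hd1] := n1.
have [r hr ar] := @adr t (t + d1) (ltac:(rewrite ltrDl//)).
have [l hl al] := @adl t (t - d1) (ltac:(lra)).
pose d := Num.min (r - t) (t - l).
have [dr dl] : d <= r - t /\ d <= t - l by rewrite /d; split; case: (leP (r - t)); lra.
have d0 : 0 < d by rewrite /d lt_min; lra.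
exists d => // u v h1 h2 h3.
have hl2 : L l t <= e / 2.
  rewrite curve_length_additive//; last lra.
  rewrite metric_sym ltW//; apply: hd1; rewrite /ball_ /= ger0_norm; lra.
have hr2 : L t r <= e / 2.
  rewrite curve_length_additive//; last lra.
  rewrite ltW//; apply: hd1; rewrite /ball_ /= ltr0_norm; lra.
have E1 : L l r = L l t + L t r by apply: curve_lengthD; lra.
have E2 : L l r = L l u + L u r by apply: curve_lengthD; lra.
have E3 : L u r = L u v + L v r by apply: curve_lengthD; lra.
have p1 : 0 <= L l u by apply: le_trans (curve_length_ge _); rewrite ?mdist_ge0//; lra.
have p2 : 0 <= L v r by apply: le_trans (curve_length_ge _); rewrite ?mdist_ge0//; lra.
lra.
Qed.

Lemma curve_length_ge0 a b : a <= b -> 0 <= L a b.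
Proof. by move=> ab; apply: le_trans (curve_length_ge ab); exact: mdist_ge0. Qed.

Lemma curve_length_cvgr (I : Type) (F : set_system I) {FF : Filter F}
    (x : I -> R) (a t : R) : a < t -> x @ F --> t ->
  L a (x i) @[i --> F] --> L a t.
Proof.
move=> at_ xt; apply/cvgrPdist_lt => e e0.
have [d d0 hd] := @curve_length_small t (e / 2) (ltac:(lra)).
near=> i.
have h1 : a < x i by near: i; apply: (cvgr_gt _ xt).
have h2 : `|t - x i| < d by near: i; move/cvgrPdist_lt : xt; apply.
move: h2; rewrite ltr_norml => h2.
have [tx|/ltW xt'] := leP t (x i).
  have -> : L a t - L a (x i) = - L t (x i).
    by rewrite (@curve_lengthD a (x i) t)//; [ring|lra].
  by rewrite normrN ger0_norm ?curve_length_ge0//; have := hd t (x i); lra.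
have -> : L a t - L a (x i) = L (x i) t.
  by rewrite (@curve_lengthD a t (x i))//; [ring|lra].
by rewrite ger0_norm ?curve_length_ge0//; have := hd (x i) t; lra.
Unshelve. all: by end_near. Qed.

Lemma curve_length_cvgl (I : Type) (F : set_system I) {FF : Filter F}
    (x : I -> R) (b t : R) : t < b -> x @ F --> t ->
  L (x i) b @[i --> F] --> L t b.
Proof.
move=> tb xt; apply/cvgrPdist_lt => e e0.
have [d d0 hd] := @curve_length_small t (e / 2) (ltac:(lra)).
near=> i.
have h1 : x i < b by near: i; apply: (cvgr_lt _ xt).
have h2 : `|t - x i| < d by near: i; move/cvgrPdist_lt : xt; apply.
move: h2; rewrite ltr_norml => h2.
have [tx|/ltW xt'] := leP t (x i).
  have -> : L t b - L (x i) b = L t (x i).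
    by rewrite (@curve_lengthD t b (x i))//; [ring|lra].
  by rewrite ger0_norm ?curve_length_ge0//; have := hd t (x i); lra.
have -> : L t b - L (x i) b = - L (x i) t.
  by rewrite (@curve_lengthD (x i) b t)//; [ring|lra].
by rewrite normrN ger0_norm ?curve_length_ge0//; have := hd (x i) t; lra.
Unshelve. all: by end_near. Qed.

End length_of_curve.

(** * Shadows and sectors *)

Section more_geodesics.
Context {R : realType} {X : metricType R}.
Hypotheses (g1 : G1 X) (properX : proper_space X).

Lemma gline_on (c : R -> X) a b v : isoline c -> a <> b ->
  exists w, gline (c a) (c b) v = c w.
Proof.
move=> ci ab; have [h|h|//] := ltgtP a b.
  by exists (a + v); rewrite gline_lt.
by exists (a - v); rewrite gline_gt.
Qed.

Lemma convex_closure (A : set X) : open A -> geodesically_convex A ->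
  forall x y, closure A x -> closure A y -> segment x y `<=` closure A.
Proof.
move=> oA cA x y Ax Ay; have [<-|/eqP xy] := eqVneq x y.
  by rewrite segmentxx// => z ->.
rewrite segment_gline// => z [u /=]; rewrite in_itv /= => hu <- {z}.
pose F := within (A `*` A) (nbhs (x, y)).
have PF : ProperFilter F.
  apply: within_nbhs_proper.
  move=> B [[B1 B2] /= [b1 b2] hB].
  have [x' [Ax' Bx']] := Ax _ b1; have [y' [Ay' By']] := Ay _ b2.
  by exists (x', y'); split => //; apply: hB.
have Fx : fst @ F --> x by apply: cvg_within_filter; exact: cvg_fst.
have Fy : snd @ F --> y by apply: cvg_within_filter; exact: cvg_snd.
have d0 : 0 < mdist x y by rewrite mdist_gt0; exact/eqP.
have Fd : mdist q.1 q.2 @[q --> F] --> mdist x y by exact: cvg_mdist.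
(* Keeping the proportion [u / mdist x y] instead of the parameter [u] ensures that the
   approximating point lies on the segment between the approximating ends. *)
have Fu : u * (mdist q.1 q.2 / mdist x y) @[q --> F] --> u.
  rewrite -[X in _ --> X]mulr1 -(divff (lt0r_neq0 d0)).
  by apply: cvgM; [exact: cvg_cst|apply: cvgM => //; exact: cvg_cst].
have h : gline q.1 q.2 (u * (mdist q.1 q.2 / mdist x y)) @[q --> F]
    --> gline x y u by exact: gline_cvg.
apply: (closed_cvgW (@closed_closure _ A) _ h).
have : \forall q \near F, 0 < mdist q.1 q.2 by exact: (cvgr_gt _ Fd).
have : F (A `*` A) by exact: withinT.
apply: filterS2 => -[q r] /= [Aq Ar] qr; apply: subset_closure.
apply: (cA _ _ Aq Ar); rewrite segment_gline//; last first.
  by apply/eqP; rewrite -mdist_gt0.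
eexists; last reflexivity; rewrite /= in_itv /=.
have k1 : 0 <= u / mdist x y <= 1.
  by rewrite divr_ge0 ?mdist_ge0//= ?ler_pdivrMr// ?mul1r; lra.
have -> : u * (mdist q r / mdist x y) = (u / mdist x y) * mdist q r by ring.
rewrite mulr_ge0 ?mdist_ge0//=; last lra.
by rewrite ler_piMl ?mdist_ge0//; lra.
Qed.

End more_geodesics.

Section shadow.
Context {R : realType} {X : metricType R}.
Hypotheses (g1 : G1 X) (properX : proper_space X).
Variables (K : set X) (g : R -> X).
Hypotheses (openK : open K) (convK : geodesically_convex K) (K0 : K !=set0)
  (bndK : metric_bounded K).
Hypothesis hg : clockwise_parametrization (frontier K) g.
Variable th : X.
Hypothesis fth : frontier K th.

Let b := base g th.
Let sp x := second_point K th x.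
Definition shadow x := pos g th (second_point K th x).

Let cl_th : closure K th.
Proof. by case: fth. Qed.

Let nK_th : ~ K th.
Proof. by move/(frontierP openK) : fth => -[]. Qed.

Let nK_front z : frontier K z -> ~ K z.
Proof. by move=> /(frontierP openK)[]. Qed.

Let spP x : K x ->
  [/\ frontier K (sp x), sp x <> th, mdist th x < mdist th (sp x),
      sp x = gline th x (mdist th (sp x)) & x = gline th (sp x) (mdist th x)].
Proof. exact: second_pointP. Qed.

Lemma shadowP x : K x -> base g th < shadow x < base g th + 1 /\
  g (shadow x) = second_point K th x.
Proof. by move=> Kx; have [h1 h2 _ _ _] := spP Kx; exact: (posP hg). Qed.

Lemma segment_second_point x : K x -> segment th (second_point K th x) x.
Proof.
move=> Kx; have [h1 h2 h3 _ h4] := spP Kx.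
rewrite segment_gline//; last exact/nesym.
by eexists; last exact/esym/h4; rewrite /= in_itv /= mdist_ge0 ltW.
Qed.

Lemma shadow_cvg (I : Type) (F : set_system I) {FF : Filter F} (x : I -> X) a :
  K a -> (\forall i \near F, K (x i)) -> x @ F --> a ->
  shadow (x i) @[i --> F] --> shadow a.
Proof.
move=> Ka FK xa; have [h1 h2 _ _ _] := spP Ka.
apply: (pos_cvg hg) => //.
  by apply: filterS FK => i /spP[].
by apply: second_point_cvg => //; [exact: filterE|exact: cvg_cst].
Qed.

Lemma shadow_gline z u : frontier K z -> z <> th -> K (gline th z u) ->
  shadow (gline th z u) = pos g th z.
Proof.
move=> fz zth Ku; have thz : th <> z by exact/nesym.
have := @second_point_eq _ _ g1 properX K openK convK K0 bndK (gline th z) 0 (mdist th z) u.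
rewrite /shadow gline0 gline1// => -> //; first exact: gline_iso.
by move=> h; apply: thz; apply: mdist_positivity.
Qed.

Lemma shadow_segment z y : frontier K z -> z <> th -> K y -> segment th z y ->
  shadow y = pos g th z.
Proof.
move=> fz zth Ky; have thz : th <> z by exact/nesym.
by rewrite segment_gline// => -[u _ uy]; rewrite -uy in Ky *; exact: shadow_gline.
Qed.

(** For [t] near [shadow x], the point at distance [mdist th x] from [th] on the line towards [g t]
    is close to [x] and has shadow exactly [t]. *)
Lemma shadow_open U x : open U -> U `<=` K -> U x ->
  \forall t \near shadow x, exists2 y, U y & shadow y = t.
Proof.
move=> oU UK Ux; have Kx := UK _ Ux.
have [f2 zth d _ xE] := spP Kx; have [hp gp] := shadowP Kx.
have xE' : gline th (g (shadow x)) (mdist th x) = x by rewrite gp -xE.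
have cvg1 : gline th (g t) (mdist th x) @[t --> shadow x] --> x.
  rewrite -[X in _ --> X]xE'; apply: gline_cvg => //.
  - exact: cvg_cst.
  - exact: (curve_cont hg).
  - exact: cvg_cst.
  - by rewrite gp; exact/nesym.
have /andP[hp1 hp2] := hp.
have nU : \forall t \near shadow x, U (gline th (g t) (mdist th x)).
  by apply: (cvg1 U); exact: open_nbhs_nbhs.
near=> t.
have ht : base g th < t < base g th + 1.
  by apply/andP; split; near: t; [exact: lt_nbhsr|exact: lt_nbhsl].
have Uy : U (gline th (g t) (mdist th x)).
  by near: t; exact: nU.
exists (gline th (g t) (mdist th x)) => //.
rewrite shadow_gline.
- exact: (posE hg).
- exact: (curve_in hg).
- exact: (curve_neq_base hg).
- exact: UK.
Unshelve. all: by end_near. Qed.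

Lemma shadow_eq_collinear (c : R -> X) s u : isoline c -> s <> u ->
  K (c s) -> K (c u) -> shadow (c s) = shadow (c u) -> range c th.
Proof.
move=> ci su Ks Ku E.
have spE : sp (c s) = sp (c u) by rewrite /sp -(shadowP Ks).2 E (shadowP Ku).2.
have [_ zth _ _ e1] := spP Ks; have [_ _ _ _ e2] := spP Ku.
have thz : th <> sp (c s) by exact/nesym.
have ri := gline_iso g1 thz.
rewrite -(line_of_uniq g1 (isoline_line_of ri) ci su); last 2 first.
- by exists (mdist th (c s)).
- by exists (mdist th (c u)) => //; rewrite spE.
by exists 0 => //; rewrite gline0.
Qed.

Lemma collinear_shadow_eq (c : R -> X) a s u : isoline c -> c a = th ->
  K (c s) -> K (c u) -> shadow (c s) = shadow (c u).
Proof.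
move=> ci ca Ks Ku; rewrite /shadow; congr pos.
have as_ : a <> s by move=> h; apply: nK_th; rewrite -ca h.
have [f z _ zE _] := spP Ks.
have [w wE] : exists w, sp (c s) = c w.
  by rewrite zE -ca; apply: gline_on.
rewrite -/(sp (c s)) wE; rewrite wE in f z.
rewrite -ca (@second_point_eq _ _ g1 properX K openK convK K0 bndK c a w u)//.
  by move=> h; apply: z; rewrite -h ca.
by rewrite ca.
Qed.

(* Unless the line passes through [th], where the shadow is constant, the shadow
   is injective along the line, hence monotone. *)
Lemma shadow_between (c : R -> X) s r u : isoline c -> s < r -> r < u ->
  K (c s) -> K (c u) ->
  if `[< range c th >] then shadow (c s) = shadow (c r) /\ shadow (c r) = shadow (c u)
  else shadow (c s) < shadow (c r) < shadow (c u) \/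
       shadow (c u) < shadow (c r) < shadow (c s).
Proof.
move=> ci sr ru Ks Ku.
have Kv v : s <= v <= u -> K (c v) by move=> ?; exact: (convex_isoline g1 convK ci Ks Ku).
have Kr : K (c r) by apply: Kv; lra.
case: asboolP => [[a _ ca]|nth].
  by split; apply: (collinear_shadow_eq ci ca).
apply: (@continuous_inj_between _ (fun v => shadow (c v)) s u) => //.
  apply/subspace_continuousP => v; rewrite /= in_itv /= => hv.
  apply: shadow_cvg; first exact: Kv.
    by rewrite near_withinE; near=> w; rewrite /= in_itv /=; exact: Kv.
  by apply: cvg_within_filter; exact: isoline_cont.
move=> v w; rewrite !in_itv /= => hv hw E; apply: contrapT => vw.
by apply: nth; apply: (shadow_eq_collinear ci vw) => //; exact: Kv.
Unshelve. all: by end_near. Qed.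

Lemma outer_ray_unbounded (c : R -> X) a : isoline c ->
  ~ metric_bounded (c @` `[a, +oo[).
Proof.
move=> ci [M hM]; pose t := a + `|M| + 1.
have := hM (c a) (c t) => /(_ _ _); rewrite ci => h.
have : `|a - t| <= M.
  apply: h; [exists a|exists t] => //=; rewrite in_itv /= ?lexx// /t.
  by have := normr_ge0 M; lra.
have n0 := normr_ge0 M; have n1 := ler_norm M.
by rewrite /t ler0_norm; lra.
Qed.

(** A ray is connected and unbounded; if it avoids [J], it forces the component of its origin to be
    unbounded. *)
Lemma outer_ray_component (c : R -> X) a (J : set X) : isoline c ->
  (forall t, a <= t -> ~ J (c t)) -> ~ region_bounded_by J (c a).
Proof.
move=> ci nJ [_ [M hM]]; apply: (@outer_ray_unbounded c a ci); exists M.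
have sub : c @` `[a, +oo[ `<=` connected_component (~` J) (c a).
  apply: connected_component_max.
  - by exists a => //=; rewrite in_itv /= lexx.
  - by move=> z [t /=]; rewrite in_itv /= andbT => /nJ ? <-.
  - apply: connected_continuous_connected.
      by apply/connected_intervalP; exact: interval_is_interval.
    by apply: continuous_subspaceT; exact: isoline_cont.
by move=> x y /sub hx /sub hy; exact: hM.
Qed.

(** * Sectors as sets of points with shadow in an interval *)

Section sector.
Variables eta xi : X.
Hypotheses (feta : frontier K eta) (fxi : frontier K xi)
  (eta_th : eta <> th) (xi_th : xi <> th).

Let lo := Num.min (pos g th eta) (pos g th xi).
Let hi := Num.max (pos g th eta) (pos g th xi).
Let J := segment th xi `|` segment th eta `|` arc g th xi eta.

Let arcE : arc g th xi eta = g @` `[lo, hi].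
Proof. by rewrite /arc minC maxC. Qed.

Let lo_hi : b < lo /\ hi < b + 1.
Proof.
have [h1 _] := posP hg fth feta eta_th; have [h2 _] := posP hg fth fxi xi_th.
by rewrite /lo /hi /b; case: (leP (pos g th eta)); lra.
Qed.

Let ends t : t = lo \/ t = hi -> segment th (g t) `<=` J.
Proof.
have [_ h1] := posP hg fth feta eta_th; have [_ h2] := posP hg fth fxi xi_th.
rewrite /lo /hi; case: (leP (pos g th eta) (pos g th xi)) => _ [->|->]; rewrite ?h1 ?h2 => z hz;
  by left; (by left) || right.
Qed.

(** Any other point off [J] escapes to infinity. Outside [K], the escape is along a ray pointing
    away from a point of [K]: by convexity it does not return to the closure of [K]. Inside [K], it
    is along the ray from [th]: meeting one of the two segments would make the shadow an end of the
    interval, and meeting the arc would put the shadow in the interval. *)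
Lemma sector_sub x : sector g th eta xi x -> K x /\ lo < shadow x < hi.
Proof.
rewrite /sector -/J => sx; have nJx : ~ J x by case: sx.
have [Kx|nKx] := pselect (K x); last first.
  exfalso; have [q Kq] := K0.
  have qx : q <> x by move=> h; apply: nKx; rewrite -h.
  have ci := gline_iso g1 qx.
  have := @outer_ray_component (gline q x) (mdist q x) J ci.
  rewrite gline1//; apply => // t; rewrite le_eqVlt => /predU1P[<-|xt].
    by rewrite gline1.
  move=> Jt; apply: nKx; rewrite -(gline1 g1 qx).
  apply: (@open_convex_lt _ _ g1 properX K openK convK _ 0 t) => //.
  - by rewrite gline0.
  - have cvxK := convex_closure g1 properX openK convK.
    case: Jt => [[]|].
    + by apply: cvxK => //; case: fxi.
    + by apply: cvxK => //; case: feta.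
    + by move=> [s _ <-]; case: (curve_in hg s).
  - by rewrite mdist_ge0.
split => //; have [hp gp] := shadowP Kx.
have nends t : t = lo \/ t = hi -> shadow x <> t.
  move=> ht E; apply: nJx; apply: (ends ht); rewrite -E gp.
  exact: segment_second_point.
apply: contrapT => nin.
have out : shadow x < lo \/ hi < shadow x.
  have := nends lo (or_introl erefl); have := nends hi (or_intror erefl).
  move=> /eqP n1 /eqP n2; have [h|h] := ltP (shadow x) lo; first by left.
  right; rewrite ltNge; apply/negP => h'; apply: nin.
  by rewrite !lt_neqAle n1 h h' eq_sym n2.
have thx : th <> x by move=> h; apply: nK_th; rewrite h.
have ci := gline_iso g1 thx; have d0 : 0 < mdist th x by rewrite mdist_gt0; exact/eqP.
have := @second_point_chord _ _ g1 properX K openK convK K0 bndK (gline th x) (mdist th x) ci.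
rewrite gline0 gline1// => /(_ fth Kx d0)[T [dT fT spE inT outT]].
have frontT t : 0 < t -> frontier K (gline th x t) -> t = T.
  move=> t0 ft; have [h|h|//] := ltgtP t T.
    by case: (nK_front ft); apply: inT; rewrite t0.
  by case: (outT t (or_intror h)); case: ft.
have noseg z t : frontier K z -> z <> th -> 0 < t -> segment th z (gline th x t) ->
    shadow x = pos g th z.
  move=> fz zth t0; have thz : th <> z by exact/nesym.
  rewrite segment_gline// => -[u _ uE].
  have u0 : 0 <> u.
    move=> h; rewrite -h gline0 in uE.
    have : gline th x 0 = gline th x t by rewrite gline0.
    by move/(isoline_inj ci) => h0; rewrite -h0 ltxx in t0.
  have rE : range (gline th x) = range (gline th z).
    apply: (line_of_uniq g1 (isoline_line_of ci) (gline_iso g1 thz) u0).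
      by exists 0; rewrite ?gline0.
    by exists t.
  have [w _ wE] : range (gline th z) x.
    by rewrite -rE; exists (mdist th x) => //; rewrite gline1.
  by rewrite -wE; apply: shadow_gline => //; rewrite wE.
have := @outer_ray_component (gline th x) (mdist th x) J ci.
rewrite gline1//; apply => // t dt; have t0 : 0 < t by lra.
move=> -[[h|h]|].
- have E := noseg _ _ fxi xi_th t0 h.
  move: E (nends lo) (nends hi); rewrite /lo /hi.
  case: (leP (pos g th eta) (pos g th xi)) => _ E n1 n2.
    by apply: n2 => //; right.
  by apply: n1 => //; left.
- have E := noseg _ _ feta eta_th t0 h.
  move: E (nends lo) (nends hi); rewrite /lo /hi.
  case: (leP (pos g th eta) (pos g th xi)) => _ E n1 n2.
    by apply: n1 => //; left.
  by apply: n2 => //; right.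
- rewrite arcE => -[s /=]; rewrite in_itv /= => hs gs.
  have ft : frontier K (gline th x t) by rewrite -gs; exact: (curve_in hg).
  have tT := frontT _ t0 ft; have [hl1 hl2] := lo_hi.
  have : shadow x = s.
    by rewrite /shadow spE -tT -gs (posE hg)// -/b; lra.
  by lra.
Qed.

Let S := [set y | K y /\ lo < shadow y < hi].

Lemma open_shadow_itv : open S.
Proof.
rewrite openE => y [Ky hy] /=; have nK : \forall z \near y, K z by exact: open_nbhs_nbhs.
have h : shadow z @[z --> y] --> shadow y by exact: shadow_cvg.
near=> z; split; first by near: z.
apply/andP; split; near: z.
  by apply: (cvgr_gt _ h); lra.
by apply: (cvgr_lt _ h); lra.
Unshelve. all: by end_near. Qed.

(* A limit of points of [S] outside [K] lies on a segment [th, g t] of the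
   frontier; if it is not on the arc itself, an end of the arc lies beyond it. *)
Lemma closure_shadow_itv y : closure S y -> ~ J y -> S y.
Proof.
move=> cSy nJy; have PF : ProperFilter (within S (nbhs y)).
  by apply: within_nbhs_proper.
have [G [GU FG]] := ultraFilterLemma PF.
have GS : \forall z \near G, S z by apply: FG; exact: withinT.
have GK : \forall z \near G, K z by apply: filterS GS => z [].
have Gy : id @ G --> y by apply: (cvg_finer FG); exact: cvg_within.
have [t] : exists2 t : R, `[lo, hi]%classic t & shadow z @[z --> G] --> t.
  apply: ultra_compact_cvg; first exact: segment_compact.
  by apply: filterS GS => z [_]; rewrite /= in_itv /=; lra.
rewrite /= in_itv /= => ht Gt; have [hl1 hl2] := lo_hi.
have htb : b < t < b + 1 by lra.
have Gz : g (shadow z) @[z --> G] --> g t by exact: (cvg_comp _ _ Gt (@curve_cont _ _ _ _ hg t)).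
have zth : g t <> th by exact: (curve_neq_base hg).
have thz : th <> g t by exact/nesym.
have Gd : mdist th z @[z --> G] --> mdist th y by apply: cvg_mdist => //; exact: cvg_cst.
have yE : y = gline th (g t) (mdist th y).
  apply: (cvg_uniq Gy).
  have : gline th (g (shadow z)) (mdist th z) @[z --> G] --> gline th (g t) (mdist th y).
    by apply: gline_cvg => //; exact: cvg_cst.
  apply: cvg_trans; apply: near_eq_cvg; apply: filterS GK => z Kz.
  by rewrite (shadowP Kz).2; have [_ _ _ _ <-] := spP Kz.
have dle : mdist th y <= mdist th (g t).
  have Gd2 : mdist th (g (shadow z)) @[z --> G] --> mdist th (g t).
    by apply: cvg_mdist => //; exact: cvg_cst.
  apply: (ler_cvg_lim Gd Gd2); apply: filterS GK => z Kz.
  by rewrite (shadowP Kz).2; have [_ _ /ltW] := spP Kz.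
have ft : frontier K (g t) := curve_in hg t.
have ysg : segment th (g t) y.
  rewrite segment_gline//; exists (mdist th y) => //=.
  by rewrite in_itv /= mdist_ge0.
have nt e : e = lo \/ e = hi -> t <> e.
  by move=> he E; apply: nJy; apply: (ends he); rewrite -E.
have := nt lo (or_introl erefl); have := nt hi (or_intror erefl) => /eqP n1 /eqP n2.
have ht' : lo < t < hi by rewrite !lt_neqAle eq_sym n1 n2 /=; lra.
have [Ky|nKy] := pselect (K y).
  by split=> //; rewrite (shadow_segment ft zth Ky ysg) (posE hg).
exfalso; have clS : closure S `<=` closure K by apply: closure_subset => z [].
have fy : frontier K y by apply/(frontierP openK); split => //; exact: clS.
have yth : y <> th.
  by move=> h; apply: nJy; rewrite h; left; left; exact: segment_endl.
pose c := gline th (g t); pose u := mdist th y; pose T := mdist th (g t).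
have ci : isoline c by exact: gline_iso.
have u0 : 0 < u by rewrite /u mdist_gt0; apply/eqP; exact/nesym.
have cT : c T = g t by exact: gline1.
have fc v : 0 <= v <= T -> frontier K (c v).
  move=> hv; apply/(frontierP openK); split.
    apply: (convex_closure g1 properX openK convK cl_th (frontier_sub_closure ft)).
    by rewrite segment_gline//; exists v.
  move=> Kv; apply: nKy; rewrite yE -/c -/u.
  have [uv|/ltW vu] := leP u v.
    apply: (@open_convex_gt _ _ g1 properX K openK convK c v 0) => //.
      by rewrite /c gline0.
    by rewrite u0.
  have uT : u < T.
    rewrite lt_neqAle dle andbT; apply/eqP => h; apply: nJy.
    right; rewrite arcE; exists t; first by rewrite /= in_itv /=; lra.
    by rewrite yE -/c -/u h cT.
  apply: (@open_convex_lt _ _ g1 properX K openK convK c v T) => //.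
    by rewrite cT; case: ft.
  by rewrite vu.
have cth v : 0 < v -> c v <> th.
  by rewrite -(gline0 th (g t)) => v0 /(isoline_inj ci) h; rewrite h ltxx in v0.
have cont : {within `[u, T], continuous (fun v => pos g th (c v))}.
  apply/subspace_continuousP => v; rewrite /= in_itv /= => hv.
  apply: (pos_cvg hg) => //.
  - by apply: fc; lra.
  - by apply: cth; lra.
  - by rewrite near_withinE; near=> w; rewrite /= in_itv /= => hw; apply: fc; lra.
  - by apply: cvg_within_filter; exact: isoline_cont.
have [hs gs] := posP hg fth fy yth; set s := pos g th y in hs gs.
(* Between [y] and [g t] the line runs inside the frontier, so its position takes every intermediate
   value. If an end of the arc is reached, then [y] lies on the segment from [th] to that end, a
   part of [J]. *)
have cross e : e = lo \/ e = hi -> Num.min s t <= e <= Num.max s t -> False.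
  move=> he; have := @IVT _ (fun v => pos g th (c v)) u T e dle cont.
  rewrite cT (posE hg)// [c u](esym yE) => /[apply] -[v].
  rewrite in_itv /= => hv vE; apply: nJy; apply: (ends he).
  have fcv : frontier K (c v) by apply: fc; lra.
  have nv : c v <> th by apply: cth; lra.
  rewrite -vE (posP hg fth fcv nv).2.
  have := @segmentE _ _ g1 c 0 v ci; rewrite {1}/c gline0 => ->; last lra.
  by exists u; [rewrite /= in_itv /=; lra|exact/esym].
have [h|h] := ltP s lo.
  by apply: (cross lo); [left|rewrite min_l ?max_r; lra].
have [h'|h'] := ltP hi s.
  by apply: (cross hi); [right|rewrite min_r ?max_l; lra].
by apply: nJy; right; rewrite arcE; exists s => //=; rewrite in_itv /= h h'.
Unshelve. all: by end_near. Qed.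

(** In the complement of [J] the set [S] is open and relatively closed, so it contains the component
    of each of its points; these components are bounded because [K] is. *)
Lemma sectorE : sector g th eta xi = S.
Proof.
apply/seteqP; split => [x /sector_sub//|x Sx]; rewrite /sector -/J.
have nJS y : S y -> ~ J y.
  move=> [Ky hy] [[h|h]|[s _ sE]].
  - move: hy; rewrite (shadow_segment fxi xi_th Ky h) /lo /hi.
    by case: (leP (pos g th eta) (pos g th xi)) => _; rewrite ltxx ?andbF.
  - move: hy; rewrite (shadow_segment feta eta_th Ky h) /lo /hi.
    by case: (leP (pos g th eta) (pos g th xi)) => _; rewrite ltxx ?andbF.
  - by apply: (@nK_front y) => //; rewrite -sE; exact: (curve_in hg).
split; first exact: nJS.
have cc := @component_connected _ (~` J) x.
have E : connected_component (~` J) x `&` S = connected_component (~` J) x.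
  apply: cc.
  - by exists x; split => //; apply: connected_component_refl; exact: nJS.
  - by exists S => //; exact: open_shadow_itv.
  - exists (closure S); first exact: closed_closure.
    apply/seteqP; split => y [hy Sy]; split => //; first exact: subset_closure.
    by apply: closure_shadow_itv => //; exact: connected_component_sub hy.
have [M hM] := bndK; exists M => y z; rewrite -E => -[_ [Ky _]] [_ [Kz _]].
exact: hM.
Qed.

End sector.

End shadow.

(** * Tangent points *)

Section tangents.
Context {R : realType} {X : metricType R}.
Hypotheses (g1 : G1 X) (properX : proper_space X).
Variables (K P : set X) (g : R -> X).
Hypotheses (openK : open K) (convK : geodesically_convex K) (K0 : K !=set0)
  (bndK : metric_bounded K).
Hypothesis hg : clockwise_parametrization (frontier K) g.
Hypotheses (openP : open P) (convP : geodesically_convex P) (P0 : P !=set0)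
  (bndP : metric_bounded P) (clPK : closure P `<=` K).
Variable th : X.
Hypothesis fth : frontier K th.

Let sh := shadow K g th.

Let PK x : P x -> K x.
Proof. by move=> Px; apply: clPK; exact: subset_closure. Qed.

Let shP := shadowP g1 properX openK convK K0 bndK hg fth.
Let sh_open := shadow_open g1 properX openK convK K0 bndK hg fth.
Let sh_cvg := shadow_cvg g1 properX openK convK K0 bndK hg fth.

(** The extrema are attained because the closure of [P] is compact. They are strict for points of
    [P] because the shadows of an open set fill a neighbourhood of each of its shadows. *)
Lemma shadow_closure_extrema : exists x y, [/\ closure P x, closure P y &
  forall z, P z -> shadow K g th x < shadow K g th z < shadow K g th y].
Proof.
have cP : compact (closure P) by exact: compact_closure.
have cP0 : closure P !=set0.
  by have [x Px] := P0; exists x; exact: subset_closure.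
have cont : {within closure P, continuous sh}.
  apply/subspace_continuousP => x cx; apply: sh_cvg; first exact: clPK.
    by rewrite near_withinE; near=> z; exact: clPK.
  exact: cvg_within.
have [x /set_mem cx xmin] := compact_EVT_min cP0 cP cont.
have [y /set_mem cy ymax] := compact_EVT_max cP0 cP cont.
exists x, y; split => // z Pz.
have pleP w : P w -> sh x <= sh w <= sh y.
  move=> /subset_closure cw; rewrite xmin ?ymax//; exact/mem_set.
have n1 : \forall t \near sh z, sh x <= t.
  apply: filterS (sh_open openP PK Pz) => t [w Pw <-].
  by have /andP[] := pleP w Pw.
have n2 : \forall t \near sh z, t <= sh y.
  apply: filterS (sh_open openP PK Pz) => t [w Pw <-].
  by have /andP[] := pleP w Pw.
have /andP[h1 h2] := pleP _ Pz.
rewrite -!/sh !lt_neqAle h1 h2 !andbT; apply/andP; split; apply/eqP => E.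
  have : \forall t \near (sh z)^'-, sh x <= t by exact: cvg_at_left_filter n1.
  move=> h; have /(@filter_ex _ _ (at_left_proper_filter _))[t [a1 a2]] :
      \forall t \near (sh z)^'-, sh x <= t /\ t < sh z.
    by apply: filterI => //; exact: nbhs_left_lt.
  by rewrite E leNgt a2 in a1.
have : \forall t \near (sh z)^'+, t <= sh y by exact: cvg_at_right_filter n2.
move=> h; have /(@filter_ex _ _ (at_right_proper_filter _))[t [a1 a2]] :
    \forall t \near (sh z)^'+, t <= sh y /\ sh z < t.
  by apply: filterI => //; exact: nbhs_right_gt.
by rewrite -E leNgt a2 in a1.
Unshelve. all: by end_near. Qed.

Lemma shadow_closure_le x a c : closure P x ->
  (forall y, P y -> a < sh y < c) -> a <= sh x <= c.
Proof.
move=> cx h; have PF : ProperFilter (within P (nbhs x)).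
  exact: within_nbhs_proper.
have cv : sh y @[y --> within P (nbhs x)] --> sh x.
  apply: sh_cvg; first exact: clPK.
    by rewrite near_withinE; near=> z => /PK.
  exact: cvg_within.
apply/andP; split.
  apply: (ler_cvg_lim (cvg_cst a) cv).
  by rewrite near_withinE; near=> z => /h /andP[/ltW].
apply: (ler_cvg_lim cv (cvg_cst c)).
by rewrite near_withinE; near=> z => /h /andP[_ /ltW].
Unshelve. all: by end_near. Qed.

Lemma tangent_pointsP : exists A B,
  [/\ base g th < A /\ B < base g th + 1, A < B,
      eta_of K P g th = g A /\ xi_of K P g th = g B,
      (forall x, P x -> A < shadow K g th x < B) &
      (forall t, A < t < B -> exists2 x, P x & shadow K g th x = t)].
Proof.
have [x [y [cx cy xy]]] := shadow_closure_extrema.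
have Kx := clPK cx; have Ky := clPK cy.
pose A := sh x; pose B := sh y.
have [hA gA] := shP Kx; have [hB gB] := shP Ky; rewrite -/(sh _) -/A -/B in hA hB gA gB.
have AB : A < B by have [z /xy/andP[]] := P0; exact: lt_trans.
have posA : pos g th (g A) = A by exact: (posE hg).
have posB : pos g th (g B) = B by exact: (posE hg).
have fA : frontier K (g A) := curve_in hg A; have fB : frontier K (g B) := curve_in hg B.
have nA : g A <> th by exact: (curve_neq_base hg).
have nB : g B <> th by exact: (curve_neq_base hg).
have sE eta xi : frontier K eta -> frontier K xi -> eta <> th -> xi <> th ->
    sector g th eta xi = [set y | K y /\
      Num.min (pos g th eta) (pos g th xi) < sh y
      < Num.max (pos g th eta) (pos g th xi)].
  by move=> *; exact: (sectorE g1 properX openK convK K0 bndK hg fth).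
have candAB : sector_candidate K P g th (g A) (g B).
  split => // z Pz; rewrite sE// posA posB min_l ?max_r ?ltW//.
  by split; [exact: PK|exact: xy].
have cand_le eta xi : sector_candidate K P g th eta xi ->
    Num.min (pos g th eta) (pos g th xi) <= A /\
    B <= Num.max (pos g th eta) (pos g th xi).
  move=> [f1 f2 n1 n2 Ps].
  have h z : P z -> Num.min (pos g th eta) (pos g th xi) < sh z
      < Num.max (pos g th eta) (pos g th xi).
    by move=> /Ps; rewrite sE// => -[].
  have /andP[h1 _] := shadow_closure_le cx h.
  by have /andP[_ h2] := shadow_closure_le cy h.
have sub eta xi : sector_candidate K P g th eta xi ->
    sector g th (g A) (g B) `<=` sector g th eta xi.
  move=> ce; have [h1 h2] := cand_le _ _ ce; case: ce => f1 f2 n1 n2 _.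
  rewrite !sE// posA posB (min_l (ltW AB)) (max_r (ltW AB)) => z [Kz hz].
  by split => //; apply/andP; split; lra.
have tAB : tangent_points K P g th (g A, g B).
  split => //; last by rewrite posA posB.
  by move=> eta xi ce s1; apply/seteqP; split => //; exact: sub.
have uAB q : tangent_points K P g th q -> q = (g A, g B).
  case: q => eta xi [ce min lt]; have sAB := min _ _ candAB (sub _ _ ce).
  have mE : Num.min (pos g th eta) (pos g th xi) = pos g th eta by rewrite min_l// ltW.
  have ME : Num.max (pos g th eta) (pos g th xi) = pos g th xi by rewrite max_r// ltW.
  have [h1 h2] := cand_le _ _ ce; case: (ce) => f1 f2 n1 n2 _.
  move: sAB; rewrite !sE// posA posB mE ME min_l ?max_r ?ltW// => sAB.
  rewrite mE ME in h1 h2.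
  have [_ ge] := posP hg fth f1 n1; have [_ gx] := posP hg fth f2 n2.
  have mem t w : K w -> sh w = t -> pos g th eta < t < pos g th xi -> A < t < B.
    move=> Kw wt ht.
    have : [set y | K y /\ pos g th eta < sh y < pos g th xi] w by split; rewrite ?wt.
    by rewrite -sAB => -[_]; rewrite wt.
  (* Shadows of points of [K] fill a neighbourhood of [A]. A larger sector would therefore contain a
     point with shadow just below [A], so equal sectors have equal ends. *)
  have E1 : pos g th eta = A.
    apply/eqP; rewrite eq_le h1 leNgt; apply/negP => lt1.
    have n : \forall t \near A, exists2 w, K w & sh w = t by exact: (sh_open openK).
    have /(@filter_ex _ _ (at_left_proper_filter _))[t [[[w Kw wt] t1] t2]] :
        \forall t \near A^'-, ((exists2 w, K w & sh w = t) /\ t < A) /\ pos g th eta < t.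
      apply: filterI; first apply: filterI.
      - exact: cvg_at_left_filter n.
      - exact: nbhs_left_lt.
      - exact: nbhs_left_gt.
    by have := mem _ _ Kw wt; lra.
  have E2 : pos g th xi = B.
    apply/eqP; rewrite eq_le h2 andbT leNgt; apply/negP => lt1.
    have n : \forall t \near B, exists2 w, K w & sh w = t by exact: (sh_open openK).
    have /(@filter_ex _ _ (at_right_proper_filter _))[t [[[w Kw wt] t1] t2]] :
        \forall t \near B^'+, ((exists2 w, K w & sh w = t) /\ B < t) /\ t < pos g th xi.
      apply: filterI; first apply: filterI.
      - exact: cvg_at_right_filter n.
      - exact: nbhs_right_gt.
      - exact: nbhs_right_lt.
    by have := mem _ _ Kw wt; lra.
  by rewrite -ge -gx E1 E2.
exists A, B; split => //; first by case/andP : hA; case/andP : hB.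
  rewrite /eta_of /xi_of.
  by case: xgetP => [q _ /uAB ->//|/(_ (g A, g B))].
move=> t /andP[At tB].
have near_pt c z : closure P z -> (\forall s \near sh z, c s) -> exists2 w, P w & c (sh w).
  move=> cz cn; have PF : ProperFilter (within P (nbhs z)).
    exact: within_nbhs_proper.
  have cv : sh y @[y --> within P (nbhs z)] --> sh z.
    apply: sh_cvg; first exact: clPK.
      by rewrite near_withinE; near=> v => /PK.
    exact: cvg_within.
  have /filter_ex[w [h1 h2]] : \forall w \near within P (nbhs z), P w /\ c (sh w).
    by apply: filterI; [exact: withinT|exact: cv].
  by exists w.
(* Points of [P] close to [x] and [y] have shadows on the two sides of [t]; the segment joining them
   stays in [P] and attains the value [t]. *)
have [u Pu ut] := near_pt (fun s => s < t) x cx (lt_nbhsl At).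
have [v Pv tv] := near_pt (fun s => t < s) y cy (lt_nbhsr tB).
have uv : u <> v by move=> E; move: ut tv; rewrite E => h1 h2; have := lt_trans h1 h2; rewrite ltxx.
have ci := gline_iso g1 uv.
have Pc s : 0 <= s <= mdist u v -> P (gline u v s).
  by move=> hs; apply: (convP Pu Pv); rewrite segment_gline//; exists s.
have cont : {within `[0, mdist u v], continuous (fun s => sh (gline u v s))}.
  apply/subspace_continuousP => s; rewrite /= in_itv /= => hs.
  apply: sh_cvg; first exact/PK/Pc.
    by rewrite near_withinE; near=> w; rewrite /= in_itv /= => /Pc/PK.
  by apply: cvg_within_filter; exact: isoline_cont.
have [] := IVT (mdist_ge0 u v) cont (v := t).
  rewrite gline0 gline1//; have uv' : sh u <= sh v by exact: ltW (lt_trans ut tv).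
  by rewrite min_l// max_r// !ltW.
by move=> s; rewrite in_itv /= => hs sE'; exists (gline u v s) => //; exact: Pc.
Unshelve. all: by end_near. Qed.

End tangents.

(** * Logarithm of the ratio in which a point divides an arc *)

Section potential.
Context {R : realType} {X : metricType R}.
Variables (C : set X) (g : R -> X).
Hypothesis hg : clockwise_parametrization C g.
Hypothesis adr : forall t b, t < b -> exists2 t', t < t' < b & additive_curve g t t'.
Hypothesis adl : forall t a, a < t -> exists2 t', a < t' < t & additive_curve g t' t.

Let L a b := curve_length a b g.
Let LD := curve_lengthD adr adl.

Lemma curve_length_gt0 a b : a < b -> b < a + 1 -> 0 < L a b.
Proof.
move=> ab ba; apply: lt_le_trans (curve_length_ge adr adl (ltW ab)).
rewrite mdist_gt0; apply/eqP => /(curve_inj hg) h.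
suff : a = b by lra.
by apply: h; rewrite ltr_norml; lra.
Qed.

Definition potential (A B t : R) := ln (curve_length A t g) - ln (curve_length t B g).

Variables A B : R.
Hypotheses (AB : A < B) (BA : B < A + 1).

Lemma potential_lt s t : A < s -> s < t -> t < B -> potential A B s < potential A B t.
Proof.
move=> As st tB; rewrite /potential; have [hAB hBA] := (AB, BA).
have p1 : 0 < L A s by apply: curve_length_gt0; lra.
have p2 : 0 < L s t by apply: curve_length_gt0; lra.
have p3 : 0 < L t B by apply: curve_length_gt0; lra.
have E1 : L A t = L A s + L s t by apply: LD; lra.
have E2 : L s B = L s t + L t B by apply: LD; lra.
apply: ltrB; rewrite ltr_ln ?posrE -?/(L _ _) ?E1 ?E2; lra.
Qed.

Lemma potential_cvg (I : Type) (F : set_system I) {FF : Filter F} (x : I -> R) t :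
  A < t < B -> x @ F --> t -> potential A B (x i) @[i --> F] --> potential A B t.
Proof.
move=> /andP[At tB] xt; have [hAB hBA] := (AB, BA); apply: cvgB.
  apply: (cvg_comp _ _ (curve_length_cvgr adr adl (curve_cont hg) At xt)).
  by apply: continuous_ln; apply: curve_length_gt0; lra.
apply: (cvg_comp _ _ (curve_length_cvgl adr adl (curve_cont hg) tB xt)).
by apply: continuous_ln; apply: curve_length_gt0; lra.
Qed.

Lemma potential_ninfty (I : Type) (F : set_system I) {FF : Filter F} (x : I -> R) M :
  (\forall i \near F, A < x i < B) -> x @ F --> A ->
  \forall i \near F, potential A B (x i) <= M.
Proof.
move=> FAB xA; have [hAB hBA] := (AB, BA); pose m := (A + B) / 2.
have hm : A < m < B by rewrite /m; lra.
have p1 : 0 < L m B by apply: curve_length_gt0; rewrite /m; lra.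
(* With this bound, [ln (L A x) <= M + ln (L m B) <= M + ln (L x B)] once [x] lies before the
   midpoint [m]. *)
have [d d0 hd] := curve_length_small adr adl (curve_cont hg) A (expR_gt0 (M + ln (L m B))).
have n1 : \forall i \near F, x i < m by apply: (cvgr_lt _ xA); rewrite /m; lra.
have n2 : \forall i \near F, x i < A + d by apply: (cvgr_lt _ xA); lra.
near=> i.
have h1 : A < x i < B by near: i.
have h2 : x i < m by near: i.
have h3 : x i < A + d by near: i.
have p2 : 0 < L A (x i) by apply: curve_length_gt0; lra.
have p3 : 0 < L (x i) m by apply: curve_length_gt0; lra.
have E : L (x i) B = L (x i) m + L m B by apply: LD; lra.
have : L A (x i) <= expR (M + ln (L m B)) by apply: hd; lra.
rewrite -ler_ln ?posrE ?expR_gt0// expRK => h4.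
have : ln (L m B) <= ln (L (x i) B) by rewrite ler_ln ?posrE ?E; lra.
by rewrite /potential -/(L _ _) -/(L (x i) B); lra.
Unshelve. all: by end_near. Qed.

Lemma potential_pinfty (I : Type) (F : set_system I) {FF : Filter F} (x : I -> R) M :
  (\forall i \near F, A < x i < B) -> x @ F --> B ->
  \forall i \near F, M <= potential A B (x i).
Proof.
move=> FAB xB; have [hAB hBA] := (AB, BA); pose m := (A + B) / 2.
have hm : A < m < B by rewrite /m; lra.
have p1 : 0 < L A m by apply: curve_length_gt0; rewrite /m; lra.
have [d d0 hd] := curve_length_small adr adl (curve_cont hg) B (expR_gt0 (ln (L A m) - M)).
have n1 : \forall i \near F, m < x i by apply: (cvgr_gt _ xB); rewrite /m; lra.
have n2 : \forall i \near F, B - d < x i by apply: (cvgr_gt _ xB); lra.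
near=> i.
have h1 : A < x i < B by near: i.
have h2 : m < x i by near: i.
have h3 : B - d < x i by near: i.
have p2 : 0 < L (x i) B by apply: curve_length_gt0; lra.
have p3 : 0 < L m (x i) by apply: curve_length_gt0; lra.
have E : L A (x i) = L A m + L m (x i) by apply: LD; lra.
have : L (x i) B <= expR (ln (L A m) - M) by apply: hd; lra.
rewrite -ler_ln ?posrE ?expR_gt0// expRK => h4.
have : ln (L A m) <= ln (L A (x i)) by rewrite ler_ln ?posrE ?E; lra.
by rewrite /potential -/(L _ _) -/(L A (x i)); lra.
Unshelve. all: by end_near. Qed.

(** Translating partitions by an integer gives one inequality for every integer, and the inverse
    translation gives the other. It allows arcs cut at different base points to be compared inside
    one fixed interval. *)
Lemma curve_length_shift a b (z : int) : a <= b ->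
  L (a + z%:~R) (b + z%:~R) = L a b.
Proof.
have le n u v : u <= v -> L u v <= L (u + n%:~R) (v + n%:~R).
  move=> uv; apply: (curve_length_le adr adl uv) => s hs.
  have -> : polyline_length g u s = polyline_length g (u + n%:~R) [seq x + n%:~R | x <- s].
    by elim: (s) (u) => //= x l ih w; rewrite ih !(curve_period hg).
  apply: (polyline_le_length adr adl); case: hs => h1 h2; split.
    move: h1; elim: (s) (u) => //= x l ih w /andP[wx xl].
    by rewrite ltrD2r wx ih.
  by rewrite (last_map (fun x => x + n%:~R)) (eqP h2).
move=> ab; apply/eqP; rewrite eq_le le// andbT.
have := @le (- z) (a + z%:~R) (b + z%:~R); rewrite lerD2r => /(_ ab).
by rewrite mulrNz !addrK.
Qed.

End potential.

(** * Weighted sums of distances *)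

Section series.
Context {R : realType}.

Lemma series_ge_sum (u : nat -> R) N : (forall i, 0 <= u i) -> cvgn (series u) ->
  \sum_(0 <= i < N) u i <= limn (series u).
Proof.
move=> u0 cu; have nd : nondecreasing_seq (series u).
  by apply/nondecreasing_seqP => n; rewrite /series /= big_nat_recr//= lerDl.
exact: (nondecreasing_cvgn_le nd cu N).
Qed.

Lemma series_ge_term (u : nat -> R) i : (forall i, 0 <= u i) -> cvgn (series u) ->
  u i <= limn (series u).
Proof.
move=> u0 cu; apply: le_trans (series_ge_sum i.+1 u0 cu).
by rewrite big_nat_recr//= lerDr sumr_ge0.
Qed.

End series.

(** Such a map is [s |-> r 0 + e * s] with [e = r 1 - r 0] of square one. Squaring the distances to
    the images of [0] and [1] turns this into polynomial identities, with no case distinction on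
    signs. *)
Lemma real_isometry_surj (R : realType) (r : R -> R) :
  (forall s t, `|r s - r t| = `|s - t|) -> forall v, exists s, r s = v.
Proof.
move=> hr v.
have sq s t : (r s - r t) ^+ 2 = (s - t) ^+ 2.
  rewrite -(real_normK (num_real (r s - r t))) hr.
  exact/real_normK/num_real.
pose e := r 1 - r 0; have ee : e * e = 1.
  by have := sq 1 0; rewrite subr0 expr1n expr2.
exists (e * (v - r 0)); set s := e * (v - r 0); pose q := r s - r 0.
have E1 : q * q = s * s by have := sq s 0; rewrite subr0 !expr2.
have E2 : (q - e) * (q - e) = (s - 1) * (s - 1).
  by have := sq s 1; rewrite !expr2 => <-; rewrite /q /e; ring.
have E3 : e * q = s.
  have : (q - e) * (q - e) = q * q - 2 * (e * q) + e * e by ring.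
  rewrite E2 E1 ee.
  have -> : (s - 1) * (s - 1) = s * s - 2 * s + 1 by ring.
  by lra.
have E4 : q = v - r 0.
  by rewrite -[LHS]mul1r -[RHS]mul1r -ee -!mulrA E3.
by apply: (@addIr _ (- r 0)).
Qed.

Section weighted_sum_metric.
Context {R : realType} {X : metricType R}.
Hypotheses (g1 : G1 X) (properX : proper_space X).
Variable P : set X.
Hypotheses (openP : open P) (convP : geodesically_convex P)
  (bndP : metric_bounded P) (P_proper : exists q, ~ P q).
Variables (f : nat -> X -> R) (w : nat -> R) (d : X -> X -> R).
Hypotheses (w_gt0 : forall i, 0 < w i) (w_sum : cvgn (series w)).
Hypothesis dE : forall x y, P x -> P y ->
  d x y = limn (series (fun i => w i * `|f i x - f i y|)).
Hypothesis f_bnd : forall x, P x -> exists M : R, forall i, `|f i x| <= M.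
Hypothesis f_between : forall (c : R -> X) s r u i, isoline c -> s < r -> r < u ->
  P (c s) -> P (c u) ->
  f i (c s) <= f i (c r) <= f i (c u) \/ f i (c u) <= f i (c r) <= f i (c s).
Hypothesis f_sep : forall x y z, P x -> P y -> P z -> ~ segment x z y ->
  exists i, `|f i x - f i z| < `|f i x - f i y| + `|f i y - f i z|.
Hypothesis f_cont : forall (c : R -> X) t i, isoline c -> P (c t) ->
  f i (c s) @[s --> t] --> f i (c t).
Hypothesis f_blowup : forall (q : X), frontier P q -> exists i,
  forall (I : Type) (F : set_system I) (FF : Filter F) (x : I -> X) (M : R),
  (\forall j \near F, P (x j)) -> x @ F --> q ->
  \forall j \near F, M <= `|f i (x j)|.

Let u x y i := w i * `|f i x - f i y|.

Let u_ge0 x y i : 0 <= u x y i.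
Proof. by rewrite mulr_ge0 ?normr_ge0 ?ltW. Qed.

Let u_cvg x y : P x -> P y -> cvgn (series (u x y)).
Proof.
move=> Px Py; have [M hM] := f_bnd Px; have [N hN] := f_bnd Py.
have MN i : `|f i x - f i y| <= M + N by rewrite (le_trans (ler_normB _ _))// lerD.
have MN0 : 0 <= M + N by apply: le_trans (MN 0%N).
apply: (@series_le_cvg _ _ (fun i => (M + N) * w i)) => //.
- by move=> i; rewrite mulr_ge0// ltW.
- by move=> i; rewrite /u mulrC ler_wpM2r// ltW.
- exact: is_cvg_seriesZ w_sum.
Qed.

Let u_triangle x y z i : 0 <= u x y i + u y z i - u x z i.
Proof.
rewrite /u -!mulrDr -mulrBr; apply: mulr_ge0; first exact: ltW.
rewrite subr_ge0.
have -> : f i x - f i z = (f i x - f i y) + (f i y - f i z) by ring.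
exact: ler_normD.
Qed.

(** The defect in the triangle inequality is itself a convergent series of nonnegative terms: one
    positive term makes the inequality strict, and the defect vanishes when all terms do. *)
Let d_defect x y z : P x -> P y -> P z -> d x y + d y z - d x z =
  limn (series (fun i => u x y i + u y z i - u x z i)) /\
  cvgn (series (fun i => u x y i + u y z i - u x z i)).
Proof.
move=> Px Py Pz; have [c1 [c2 c3]] := (u_cvg Px Py, (u_cvg Py Pz, u_cvg Px Pz)).
have E : (fun i => u x y i + u y z i - u x z i) = u x y + u y z - u x z by [].
rewrite E; split; last exact: is_cvg_seriesB (is_cvg_seriesD c1 c2) c3.
by rewrite (lim_seriesB (is_cvg_seriesD c1 c2) c3) (lim_seriesD c1 c2) !dE.
Qed.

Lemma sum_dist_ge0 x y : P x -> P y -> 0 <= d x y.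
Proof.
by move=> Px Py; rewrite dE//; apply: le_trans (series_ge_term 0%N (u_ge0 x y) (u_cvg Px Py)).
Qed.

Lemma sum_dist_term x y i : P x -> P y -> w i * `|f i x - f i y| <= d x y.
Proof.
by move=> Px Py; rewrite dE//; exact: (series_ge_term i (u_ge0 x y) (u_cvg Px Py)).
Qed.

Lemma sum_dist_sym x y : P x -> P y -> d x y = d y x.
Proof.
move=> Px Py; rewrite !dE//; congr (limn (series _)); apply/funext => i.
by rewrite distrC.
Qed.

Lemma sum_distxx x : P x -> d x x = 0.
Proof.
move=> Px; rewrite dE//.
have -> : (fun i => w i * `|f i x - f i x|) = fun=> 0.
  by apply/funext => i; rewrite subrr normr0 mulr0.
have -> : series (fun=> 0 : R) = fun=> 0.
  by apply/funext => n; rewrite /series /= big1.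
exact: lim_cst.
Qed.

Lemma sum_dist_triangle x y z : P x -> P y -> P z -> d x z <= d x y + d y z.
Proof.
move=> Px Py Pz; rewrite -subr_ge0; have [-> cv] := d_defect Px Py Pz.
by apply: le_trans (series_ge_term 0%N (u_triangle x y z) cv).
Qed.

Lemma sum_dist_segment x y z : P x -> P y -> P z ->
  d x z = d x y + d y z -> segment x z y.
Proof.
move=> Px Py Pz E; apply: contrapT => /(f_sep Px Py Pz)[i hi].
have [Ed cv] := d_defect Px Py Pz.
have := series_ge_term i (u_triangle x y z) cv; rewrite -Ed E subrr leNgt.
by rewrite /u -!mulrDr -mulrBr mulr_gt0// subr_gt0.
Qed.

(** Positivity is the separation property for the degenerate triple [x, y, x]. *)
Lemma sum_dist_eq0 x y : P x -> P y -> d x y = 0 -> x = y.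
Proof.
move=> Px Py E; suff : segment x x y by rewrite segmentxx.
by apply: sum_dist_segment => //; rewrite sum_distxx// E sum_dist_sym// E addr0.
Qed.

Lemma sum_dist_additive (c : R -> X) s r t : isoline c -> s <= r -> r <= t ->
  P (c s) -> P (c t) -> d (c s) (c t) = d (c s) (c r) + d (c r) (c t).
Proof.
move=> ci; rewrite le_eqVlt => /predU1P[-> _ Pr _|sr].
  by rewrite sum_distxx// add0r.
rewrite le_eqVlt => /predU1P[-> _ Pt|rt Ps Pt].
  by rewrite sum_distxx// addr0.
have Pr : P (c r) by apply: (convex_isoline g1 convP ci Ps Pt); rewrite !ltW.
apply/esym/eqP; rewrite -subr_eq0; have [-> _] := d_defect Ps Pr Pt.
have -> : (fun i => u (c s) (c r) i + u (c r) (c t) i - u (c s) (c t) i) = fun=> 0.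
  apply/funext => i; rewrite /u -!mulrDr -mulrBr.
  have [h|h] := f_between i ci sr rt Ps Pt.
    by rewrite !ler0_norm; try lra; apply/eqP; rewrite mulf_eq0; apply/orP; right; apply/eqP; lra.
  by rewrite !ger0_norm; try lra; apply/eqP; rewrite mulf_eq0; apply/orP; right; apply/eqP; lra.
have -> : series (fun=> 0 : R) = fun=> 0.
  by apply/funext => n; rewrite /series /= big1.
by apply/eqP; exact: lim_cst.
Qed.

(** A dominated convergence argument: between the nearby points [x] and [z] of the line, each term
    is at most the corresponding term of [d x z]. The tail is thus controlled by a convergent series
    that does not depend on [s], and the remaining finite sum is continuous. *)
Lemma sum_dist_cont (c : R -> X) t : isoline c -> P (c t) ->
  d (c s) (c t) @[s --> t] --> (0 : R).
Proof.
move=> ci Pt; have nP : \forall s \near t, P (c s).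
  by apply: (isoline_cont ci); exact: open_nbhs_nbhs.
have [r0 /= r00 hr0] := nP; pose r := r0 / 2.
have r_gt0 : 0 < r by rewrite /r; lra.
have Pr s : t - r <= s <= t + r -> P (c s).
  by move=> hs; apply: hr0; rewrite /ball_ /= ltr_norml /r in hs *; lra.
pose x := c (t - r); pose z := c (t + r).
have Px : P x by apply: Pr; lra.
have Pz : P z by apply: Pr; lra.
have btw i s : t - r <= s <= t + r ->
    f i x <= f i (c s) <= f i z \/ f i z <= f i (c s) <= f i x.
  move=> /andP[h1 h2]; have [->|n1] := eqVneq s (t - r).
    by rewrite -/x; have [h|/ltW h] := leP (f i x) (f i z); [left|right]; rewrite ?lexx ?h.
  have [->|n2] := eqVneq s (t + r).
    by rewrite -/z; have [h|/ltW h] := leP (f i x) (f i z); [left|right]; rewrite ?lexx ?h.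
  by apply: f_between => //; rewrite lt_neqAle ?h1 ?h2 ?n2 // eq_sym n1.
have le i s : t - r <= s <= t + r -> `|f i (c s) - f i (c t)| <= `|f i x - f i z|.
  move=> /(btw i) hs; have : t - r <= t <= t + r by lra.
  move=> /(btw i) ht; have n1 := ler_norm (f i x - f i z).
  have n2 := ler_norm (f i z - f i x); rewrite distrC in n2.
  by rewrite ler_norml; case: hs; case: ht; lra.
apply/cvgrPdist_lt => e e0.
have cuv : series (u x z) @ \oo --> d x z by rewrite dE//; exact: u_cvg.
have [N _ /(_ N (leqnn N)) hN] : \forall n \near \oo, `|d x z - series (u x z) n| < e / 2.
  by move/cvgrPdist_lt : cuv; apply; lra.
have fin n : \sum_(0 <= i < n) u (c s) (c t) i @[s --> t] --> (0 : R).
  elim: n => [|n ih].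
    by under eq_fun do rewrite big_nil; exact: cvg_cst.
  have h : `|f n (c s) - f n (c t)| @[s --> t] --> `|f n (c t) - f n (c t)|.
    by apply: cvg_norm; apply: cvgB; [exact: f_cont|exact: cvg_cst].
  have h2 : u (c s) (c t) n @[s --> t] --> w n * `|f n (c t) - f n (c t)|.
    by apply: cvgM => //; exact: cvg_cst.
  rewrite subrr normr0 mulr0 in h2.
  have h3 : \sum_(0 <= i < n) u (c s) (c t) i + u (c s) (c t) n @[s --> t]
      --> (0 + 0 : R) by exact: cvgD.
  by under eq_fun do rewrite big_nat_recr//=; rewrite addr0 in h3.
near=> s.
have hs : t - r <= s <= t + r.
  have : `|t - s| < r.
    by near: s; have /cvgrPdist_lt := @cvg_id _ (nbhs t); apply.
  by rewrite ltr_norml; lra.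
have Ps := Pr _ hs.
have h1 : `|0 - \sum_(0 <= i < N) u (c s) (c t) i| < e / 2.
  by near: s; move/cvgrPdist_lt : (fin N); apply; lra.
have h2 : 0 <= \sum_(0 <= i < N) u (c s) (c t) i by rewrite sumr_ge0.
have h3 : 0 <= d (c s) (c t) by exact: sum_dist_ge0.
rewrite sub0r normrN ger0_norm// in h1.
suff h4 : d (c s) (c t) <= \sum_(0 <= i < N) u (c s) (c t) i + (d x z - series (u x z) N).
  rewrite sub0r normrN ger0_norm//; have := ler_norm (d x z - series (u x z) N).
  lra.
have c1 := u_cvg Ps Pt; have c2 := u_cvg Px Pz.
have v0 i : 0 <= u x z i - u (c s) (c t) i.
  by rewrite /u -mulrBr; apply: mulr_ge0; [exact: ltW|rewrite subr_ge0 le].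
have := series_ge_sum N v0 (is_cvg_seriesB c2 c1).
have -> : limn (series (fun i => u x z i - u (c s) (c t) i)) = d x z - d (c s) (c t).
  by rewrite (lim_seriesB c2 c1) !dE.
by rewrite big_split /= sumrN /series /=; lra.
Unshelve. all: by end_near. Qed.

Lemma sum_dist_unbounded (c : R -> X) t0 v : isoline c -> P (c t0) ->
  exists t, [/\ t0 <= t, P (c t) & v <= d (c t0) (c t)].
Proof.
move=> ci Pt0; have P0 : P !=set0 by exists (c t0).
have [T [t0T fT Pt _]] := exit_point g1 properX openP convP P0 bndP ci Pt0.
have [i hi] := f_blowup fT.
have nP : \forall t \near T^'-, P (c t).
  near=> t; apply: Pt; apply/andP; split; last by near: t; exact: nbhs_left_lt.
  by near: t; exact: nbhs_left_ge.
have cT : c s @[s --> T^'-] --> c T.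
  by apply: cvg_at_left_filter; exact: isoline_cont.
(* A single term of the series suffices. The threshold compensates for the value of [f i] at the
   starting point and for the weight [w i]. *)
have nM := hi _ _ (@filter_filter _ _ (at_left_proper_filter T)) c
  (`|f i (c t0)| + `|v| / w i) nP cT.
have /(@filter_ex _ _ (at_left_proper_filter T))[t [[h1 h2] h3]] :
    \forall t \near T^'-, (P (c t) /\ `|f i (c t0)| + `|v| / w i <= `|f i (c t)|) /\ t0 <= t.
  by apply: filterI; [exact: filterI|exact: nbhs_left_ge].
exists t; split => //; apply: le_trans (sum_dist_term i Pt0 h1).
rewrite distrC mulrC -ler_pdivrMr//; apply: le_trans (lerB_dist _ _).
by rewrite lerBrDl (le_trans _ h2)// lerD2l ler_pM2r ?invr_gt0// ler_norm.
Unshelve. all: by end_near. Qed.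

(** * Parametrizing a line by the new distance *)

Section along_a_line.
Variables (c : R -> X) (t0 : R).
Hypotheses (ci : isoline c) (Pt0 : P (c t0)).

(** A coordinate on the line in which [d] becomes [|h s - h t|]; its inverse parametrizes the line
    isometrically for [d]. *)
Definition signed_dist t := if t0 <= t then d (c t0) (c t) else - d (c t0) (c t).
Let h := signed_dist.

Lemma signed_distB s t : s <= t -> P (c s) -> P (c t) -> h t - h s = d (c s) (c t).
Proof.
move=> st Ps Pt; rewrite /h /signed_dist.
have [ts|ts] := leP t0 s.
  rewrite (le_trans ts st) (@sum_dist_additive c t0 s t)//; ring.
have [tt|tt] := leP t0 t.
  by rewrite (@sum_dist_additive c s t0 t) ?(ltW ts)// (@sum_dist_sym (c s))//; ring.
rewrite (@sum_dist_sym _ (c s))// (@sum_dist_additive c s t t0) ?(ltW tt)//.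
by rewrite (@sum_dist_sym _ (c t))//; ring.
Qed.

Lemma signed_dist_norm s t : P (c s) -> P (c t) -> `|h s - h t| = d (c s) (c t).
Proof.
move=> Ps Pt; have [st|/ltW ts] := leP s t.
  by rewrite distrC signed_distB// ger0_norm// sum_dist_ge0.
by rewrite signed_distB// ger0_norm ?sum_dist_ge0// sum_dist_sym.
Qed.

Lemma signed_dist_lt s t : P (c s) -> P (c t) -> (h s < h t) = (s < t).
Proof.
have lt a b : P (c a) -> P (c b) -> a < b -> h a < h b.
  move=> Pa Pb ab; rewrite -subr_gt0 signed_distB ?ltW// lt_neqAle sum_dist_ge0// andbT.
  apply/eqP => /esym /(sum_dist_eq0 Pa Pb) /(isoline_inj ci) E.
  by rewrite E ltxx in ab.
move=> Ps Pt; have [st|ts|->] := ltgtP s t; last by rewrite ltxx.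
  by rewrite lt.
by rewrite ltNge ltW// lt.
Qed.

Lemma signed_dist_surj v : exists2 t, P (c t) & h t = v.
Proof.
have [t2 [t02 P2 v2]] := sum_dist_unbounded `|v| ci Pt0.
have ci' : isoline (fun t => c (0 - t)) by exact: isoline_flip.
have [|t1' [t01 P1 v1]] := @sum_dist_unbounded _ (- t0) `|v| ci'.
  by rewrite sub0r opprK.
rewrite !sub0r opprK in P1 v1; pose t1 := - t1'.
have t10 : t1 <= t0 by rewrite /t1; lra.
have t12 : t1 <= t2 by lra.
have Pt t : t1 <= t <= t2 -> P (c t) by exact: (convex_isoline g1 convP ci).
have cont : {within `[t1, t2], continuous h}.
  apply/subspace_continuousP => t; rewrite /= in_itv /= => ht.
  have Pct := Pt _ ht; apply/cvgrPdist_lt => e e0.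
  have := sum_dist_cont ci Pct => /cvgrPdist_lt /(_ e e0) hh.
  rewrite near_withinE; near=> s; rewrite /= in_itv /= => hs.
  rewrite distrC signed_dist_norm//; last exact: Pt.
  have : `|0 - d (c s) (c t)| < e by near: s.
  by rewrite sub0r normrN ger0_norm// sum_dist_ge0//; exact: Pt.
have h2 : h t2 = d (c t0) (c t2) by rewrite /h /signed_dist t02.
have h1 : h t1 = - d (c t0) (c t1).
  rewrite /h /signed_dist; case: leP => // tt.
  have -> : t1 = t0 by lra.
  by rewrite sum_distxx// oppr0.
have [|t] := IVT t12 cont (v := v).
  have n1 := ler_norm v; have n2 := lerNnormlW (lexx `|v|).
  have v1' : `|v| <= d (c t0) (c t1) := v1.
  rewrite min_l ?max_r; rewrite h1 h2; lra.
by rewrite in_itv /= => /Pt ? <-; exists t.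
Unshelve. all: by end_near. Qed.

Lemma sum_geodesic_parametrization : exists k : R -> R,
  [/\ forall v, P (c (k v)), forall v, h (k v) = v & forall t, P (c t) -> k (h t) = t].
Proof.
have [k hk] : {k : R -> R & forall v, P (c (k v)) /\ h (k v) = v}.
  by apply: (@choice _ _ (fun v t => P (c t) /\ h t = v)) => v;
    have [t ? ?] := signed_dist_surj v; exists t.
exists k; split=> [v|v|t Pt]; [by case: (hk v)|by case: (hk v)|].
have [Pk E] := hk (h t).
by apply/eqP; rewrite eq_le !leNgt -(signed_dist_lt Pt Pk) -(signed_dist_lt Pk Pt) E ltxx.
Qed.

Lemma sum_geodesic_line : geodesic_line P d (range c `&` P).
Proof.
have [k [k1 k2 k3]] := sum_geodesic_parametrization.
exists (c \o k).
  split; first by move=> v _; exact: k1.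
  by move=> s t _ _ /=; rewrite -signed_dist_norm// !k2.
apply/seteqP; split => [_ [[t _ <-] Pt]|_ [v _ <-]].
  by exists (h t) => //=; rewrite k3.
by split; [exists (k v)|exact: k1].
Qed.

End along_a_line.

Lemma sum_geodesic_segment x y : P x -> P y ->
  geodesic_segment P d x y (segment x y).
Proof.
move=> Px Py; have [->|/eqP xy] := eqVneq x y.
  rewrite segmentxx//; exists 0, (fun=> y); split => //.
    split => // s t; rewrite /= !in_itv /= => hs ht; rewrite sum_distxx//.
    by have -> : s - t = 0; [lra|rewrite normr0].
  apply/seteqP; split => [_ ->|_ [t _ <-]//].
  by exists 0 => //=; rewrite in_itv /= lexx.
have [ci c1] := glineP g1 xy; set c := gline x y in ci c1.
have c0 : c 0 = x by exact: gline0.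
have D0 := mdist_ge0 x y; set D := mdist x y in c1 D0.
have Pc0 : P (c 0) by rewrite c0.
have PcD : P (c D) by rewrite c1.
have [k [k1 k2 k3]] := sum_geodesic_parametrization ci Pc0.
have h0 : signed_dist c 0 0 = 0 by rewrite /signed_dist lexx sum_distxx.
have hD : signed_dist c 0 D = d x y by rewrite /signed_dist D0 c0 c1.
have slt := signed_dist_lt ci Pc0.
exists (d x y), (c \o k); split.
- exact: sum_dist_ge0.
- split=> [v _|s t _ _]; first exact: k1.
  by rewrite -(signed_dist_norm ci Pc0)// !k2.
- by rewrite /= -h0 k3.
- by rewrite /= -hD k3.
rewrite segment_gline//; apply/seteqP; split => [z [t /=]|z [v /=]]; rewrite in_itv /= => ht <- {z}.
  have Pt : P (c t) by exact: (convex_isoline g1 convP ci Pc0 PcD).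
  exists (signed_dist c 0 t); last by rewrite /= k3.
  by rewrite /= in_itv /= -{1}h0 -hD !leNgt (slt _ _ Pt Pc0) (slt _ _ PcD Pt) -!leNgt.
exists (k v) => //; rewrite /= in_itv /= !leNgt -(slt _ _ (k1 v) Pc0).
by rewrite -(slt _ _ PcD (k1 v)) h0 hD k2; lra.
Qed.

(** Equality in the triangle inequality places a geodesic of [d] on the segment of [X]. Conversely,
    a point [z] of the segment is reached at time [d x z], because additivity makes a point of the
    segment determined by its [d]-distance from [x]. *)
Lemma sum_geodesic_segment_uniq x y S : P x -> P y ->
  geodesic_segment P d x y S -> S = segment x y.
Proof.
move=> Px Py [L [c0 [L0 [c0P c0d] c00 c0L ->]]].
have dxy : d x y = L.
  rewrite -c00 -c0L c0d; last 2 first.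
  - by rewrite /= in_itv /= lexx.
  - by rewrite /= in_itv /= lexx andbT.
  by rewrite sub0r normrN ger0_norm.
have dx v : 0 <= v <= L -> d x (c0 v) = v.
  move=> hv; rewrite -c00 c0d; last 2 first.
  - by rewrite /= in_itv /= lexx.
  - by rewrite /= in_itv.
  by rewrite sub0r normrN ger0_norm; lra.
have dy v : 0 <= v <= L -> d (c0 v) y = L - v.
  move=> hv; rewrite -c0L c0d; last 2 first.
  - by rewrite /= in_itv.
  - by rewrite /= in_itv /= lexx andbT.
  by rewrite ler0_norm; lra.
have inS v : 0 <= v <= L -> segment x y (c0 v).
  move=> hv; apply: sum_dist_segment => //; first by apply: c0P; rewrite /= in_itv.
  by rewrite dx// dy// dxy; ring.
apply/seteqP; split => [z [v /=]|z zS].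
  by rewrite in_itv /= => hv <-; exact: inS.
have [xy|/eqP xy] := eqVneq x y.
  move: zS; rewrite -xy segmentxx// => ->; exists 0 => //=.
  by rewrite in_itv /= lexx.
have ci := gline_iso g1 xy.
have Pz : P z by exact: (convP Px Py).
have [s hs sE] := segmentP g1 zS.
have add t : 0 <= t <= mdist x y -> d x y = d x (gline x y t) + d (gline x y t) y.
  move=> /andP[t0 tD]; have := sum_dist_additive ci t0 tD.
  by rewrite gline0 gline1//; apply.
pose v := d x z; have hv : 0 <= v <= L.
  have := add _ hs; rewrite sE dxy -/v => E.
  have := sum_dist_ge0 Pz Py; have := sum_dist_ge0 Px Pz; rewrite -/v; lra.
exists v; first by rewrite /= in_itv.
have [t ht tE] := segmentP g1 (inS _ hv).
have Pv : P (c0 v) by apply: c0P; rewrite /= in_itv.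
have E := dx _ hv; rewrite -tE -sE -/v.
have Px0 : P (gline x y 0) by rewrite gline0.
have [st|/ltW ts] := leP s t.
  have := @sum_dist_additive _ 0 s t ci; rewrite gline0 tE sE E -/v.
  move=> /(_ _ st Px Pv) => F; apply/esym.
  by apply: sum_dist_eq0 => //; have := F (ltac:(lra)); lra.
have := @sum_dist_additive _ 0 t s ci; rewrite gline0 tE sE E -/v.
move=> /(_ _ ts Px Pz) => F.
by apply: sum_dist_eq0 => //; have := F (ltac:(lra)); lra.
Qed.

Lemma segment_extend (a b e : X) : a <> b -> segment a e b -> range (gline a b) e.
Proof.
move=> ab; have [<-|/eqP ae] := eqVneq a e.
  by rewrite segmentxx// => /esym.
move=> /(segmentP g1)[v _ vE].
rewrite -(line_of_uniq g1 (isoline_line_of (gline_iso g1 ae)) (gline_iso g1 ab)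
  (a := 0) (b := mdist a b)).
- by exists (mdist a e) => //; rewrite gline1.
- by move=> /esym /mdist_positivity.
- by rewrite gline0; exists 0; rewrite ?gline0.
- by rewrite gline1//; exists v.
Qed.

(** Equality in the triangle inequality places the whole geodesic on the line of [X] through its
    points at times [0] and [1]. In the coordinate [signed_dist] it becomes an isometric map of the
    reals, hence is onto, so it fills the part of the line in [P]. *)
Lemma sum_geodesic_line_sub S : geodesic_line P d S ->
  exists2 c, isoline c & S = range c `&` P /\ S !=set0.
Proof.
move=> [c0 [c0P c0d] ->].
have dd s t : d (c0 s) (c0 t) = `|s - t| by exact: c0d.
have Pc t : P (c0 t) by exact: c0P.
have betw s r t : s <= r -> r <= t -> segment (c0 s) (c0 t) (c0 r).
  move=> sr rt; apply: sum_dist_segment => //; rewrite !dd !ler0_norm; lra.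
pose x := c0 0; pose y := c0 1.
have xy : x <> y.
  by move=> E; have := dd 0 1; rewrite -/x -/y -E (sum_distxx (Pc 0)) sub0r normrN normr1; lra.
have ci := gline_iso g1 xy; exists (gline x y) => //.
have on t : range (gline x y) (c0 t).
  have [t0|t0] := leP t 0.
    have yx : y <> x by exact/nesym.
    have : range (gline y x) (c0 t).
      by apply: segment_extend => //; rewrite segment_sym//; exact: betw.
    rewrite (line_of_uniq g1 (isoline_line_of (gline_iso g1 yx)) ci
      (a := 0) (b := mdist x y))//.
    - by move=> /esym /mdist_positivity.
    - by rewrite gline0; exists (mdist y x) => //; rewrite gline1.
    - by rewrite gline1//; exists 0; rewrite ?gline0.
  have [t1|t1] := leP t 1.
    have := betw 0 t 1 (ltW t0) t1; rewrite -/x -/y segment_gline// => -[v _ <-].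
    by exists v.
  by apply: segment_extend => //; apply: betw; lra.
split; last by exists x; exists 0.
have Px0 : P (gline x y 0) by rewrite gline0; exact: Pc.
have [k [k1 k2 k3]] := sum_geodesic_parametrization ci Px0.
apply/seteqP; split => [_ [t _ <-]//|_ [[t _ <-] Pt]].
pose h := signed_dist (gline x y) 0.
have [r rE] : {r : R -> R & forall t, gline x y (r t) = c0 t}.
  by apply: (@choice _ _ (fun t s => gline x y s = c0 t)) => s; have [v _ <-] := on s; exists v.
have hr s s' : `|h (r s) - h (r s')| = `|s - s'|.
  by rewrite (signed_dist_norm ci Px0) ?rE.
suff [s hs] : exists s, h (r s) = h t.
  by exists s => //; rewrite -rE -(k3 _ Pt) -/h -hs k3 ?rE.
exact: (real_isometry_surj (r := h \o r)).
Qed.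

Theorem weighted_sum_geodesics :
  [/\ metric_on P d,
      geodesic_space P d,
      [set S | geodesic_line P d S] =
        [set s `&` P | s in [set s | line_of s /\ s `&` P !=set0]],
      uniquely_geodesic P d &
      geodesically_complete P d].
Proof.
split.
- split; [exact: sum_dist_ge0| |exact: sum_dist_sym|exact: sum_dist_triangle].
  by move=> x y Px Py; split => [/(sum_dist_eq0 Px Py)//|->]; exact: sum_distxx.
- by move=> x y Px Py; exists (segment x y); exact: sum_geodesic_segment.
- apply/seteqP; split => S /=.
    move=> /sum_geodesic_line_sub[c ci [-> ne]]; exists (range c) => //.
    by split => //; exact: isoline_line_of.
  move=> [s [/line_ofP[c ci ->] [x [[t _ <-] Pt]]] <-].
  exact: (sum_geodesic_line ci Pt).
- move=> x y Px Py; exists (segment x y); split; first exact: sum_geodesic_segment.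
  by move=> S /(sum_geodesic_segment_uniq Px Py).
- move=> x y S Px Py /(sum_geodesic_segment_uniq Px Py) ->.
  have [q [xq sub]] : exists q, x <> q /\ segment x y `<=` range (gline x q).
    (* A degenerate segment determines no line; a point outside [P] serves as the second point
       needed to direct one. *)
    have [<-|/eqP xy] := eqVneq x y.
      have [q nPq] := P_proper; exists q; split; first by move=> E; apply: nPq; rewrite -E.
      by rewrite segmentxx// => z ->; exists 0; rewrite ?gline0.
    by exists y; split => //; rewrite segment_gline// => _ [v _ <-]; exists v.
  exists (range (gline x q) `&` P).
    by apply: (@sum_geodesic_line _ 0); [exact: gline_iso|rewrite gline0].
  by move=> z zS; split; [exact: sub|exact: (convP Px Py)].
Qed.

End weighted_sum_metric.

(** * Polygons *)

(** Points of the line within distance one of [q] have parameters bounded by [mdist (c 0) q + 1], so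
    [q] is a limit of points of a compact piece. *)
Lemma closed_isoline (R : realType) (X : metricType R) (c : R -> X) :
  isoline c -> closed (range c).
Proof.
move=> ci q clq; pose M := mdist (c 0) q + 1.
have cM : closed (c @` `[- M, M]).
  apply: compact_closed; first exact: metric_hausdorff.
  apply: continuous_compact; last exact: segment_compact.
  by apply: continuous_subspaceT; exact: isoline_cont.
suff : closure (c @` `[- M, M]) q by move=> /cM[t _ <-]; exists t.
move=> B Bq; have nq : \forall z \near q, mdist q z < 1.
  by apply: (metricType_numDomainType.cvgr_dist_lt (@cvg_id _ (nbhs q))).
have [_ [[t _ <-] [Bt qt]]] := clq _ (filterI Bq nq).
exists (c t); split => //; exists t => //=; rewrite in_itv /= -ler_norml.
have := metric_triangle (c 0) q (c t); rewrite ci sub0r normrN /M; lra.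
Qed.

Lemma ltr_dist_outside (R : realType) (a b c : R) :
  (b < a /\ b < c) \/ (a < b /\ c < b) -> `|a - c| < `|a - b| + `|b - c|.
Proof.
move=> [[h1 h2]|[h1 h2]].
  by rewrite ltr_norml gtr0_norm ?subr_gt0// ltr0_norm ?subr_lt0//; lra.
by rewrite ltr_norml ltr0_norm ?subr_lt0// gtr0_norm ?subr_gt0//; lra.
Qed.

Section polygon_geometry.
Context {R : realType} {X : metricType R}.
Hypotheses (g1 : G1 X) (properX : proper_space X).
Variables (K P : set X) (g : R -> X) (sidesK sidesP : seq (X * X)).
Hypotheses (polyK : polygon_with_sides K sidesK)
  (polyP : polygon_with_sides P sidesP) (subPK : P `|` frontier P `<=` K).
Hypothesis hg : clockwise_parametrization (frontier K) g.

Let openK : open K. Proof. by case: polyK. Qed.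
Let convK : geodesically_convex K. Proof. by case: polyK. Qed.
Let K0 : K !=set0. Proof. by case: polyK. Qed.
Let bndK : metric_bounded K. Proof. by case: polyK. Qed.
Let openP : open P. Proof. by case: polyP. Qed.
Let convP : geodesically_convex P. Proof. by case: polyP. Qed.
Let P0 : P !=set0. Proof. by case: polyP. Qed.
Let bndP : metric_bounded P. Proof. by case: polyP. Qed.

Let PK x : P x -> K x.
Proof. by move=> Px; apply: subPK; left. Qed.

Let clPK : closure P `<=` K.
Proof.
move=> x cx; apply: subPK; have [Px|nPx] := pselect (P x); [by left|right].
exact/(frontierP openP).
Qed.

Let adr t b : t < b -> exists2 t', t < t' < b & additive_curve g t t'.
Proof. by case: polyK => _ _ _ _ [_ fK]; exact: (additive_curve_right g1 hg fK). Qed.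

Let adl t a : a < t -> exists2 t', a < t' < t & additive_curve g t' t.
Proof. by case: polyK => _ _ _ _ [_ fK]; exact: (additive_curve_left g1 hg fK). Qed.

Let shP th := @shadowP _ _ g1 properX K g openK convK K0 bndK hg th.
Let sh_cvg := @shadow_cvg _ _ g1 properX K g openK convK K0 bndK hg.
Let sh_eq := @shadow_eq_collinear _ _ g1 properX K g openK convK K0 bndK hg.

Let tA th := pos g th (eta_of K P g th).
Let tB th := pos g th (xi_of K P g th).

Lemma tangentP th : frontier K th ->
  [/\ base g th < tA th /\ tB th < base g th + 1, tA th < tB th,
      eta_of K P g th = g (tA th) /\ xi_of K P g th = g (tB th),
      (forall x, P x -> tA th < shadow K g th x < tB th) &
      (forall t, tA th < t < tB th -> exists2 x, P x & shadow K g th x = t)].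
Proof.
move=> fth; have [A [B [[bA Bb] AB [eE xE] h1 h2]]] :=
  tangent_pointsP g1 properX openK convK K0 bndK hg openP convP P0 bndP clPK fth.
have -> : tA th = A by rewrite /tA eE; apply: (posE hg) => //; lra.
by have -> : tB th = B by rewrite /tB xE; apply: (posE hg) => //; lra.
Qed.

Definition theta_potential th x :=
  potential g (pos g th (eta_of K P g th)) (pos g th (xi_of K P g th))
    (shadow K g th x).

Lemma theta_potential_lt th x y : frontier K th -> P x -> P y ->
  shadow K g th x < shadow K g th y -> theta_potential th x < theta_potential th y.
Proof.
move=> fth Px Py xy; have [[h1 h2] h3 _ h4 _] := tangentP fth.
have hx := h4 _ Px; have hy := h4 _ Py.
by apply: (potential_lt hg adr adl); rewrite -?/(tA th) -?/(tB th); lra.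
Qed.

Lemma theta_potential_le th x y : frontier K th -> P x -> P y ->
  shadow K g th x <= shadow K g th y -> theta_potential th x <= theta_potential th y.
Proof.
move=> fth Px Py; rewrite le_eqVlt => /predU1P[E|].
  by rewrite /theta_potential E.
by move=> h; apply: ltW; exact: theta_potential_lt.
Qed.

Lemma dist_thetaE th x y : frontier K th -> P x -> P y ->
  dist_theta K P g th x y = `|theta_potential th x - theta_potential th y|.
Proof.
move=> fth Px Py; have [[h1 h2] h3 _ h4 _] := tangentP fth.
have lenA z : P z -> arc_length g th (eta_of K P g th) (second_point K th z) =
    curve_length (tA th) (shadow K g th z) g.
  move=> /h4 hz; rewrite /arc_length -/(shadow K g th z) -/(tA th).
  by rewrite min_l ?max_r //; lra.
have lenB z : P z -> arc_length g th (xi_of K P g th) (second_point K th z) =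
    curve_length (shadow K g th z) (tB th) g.
  move=> /h4 hz; rewrite /arc_length -/(shadow K g th z) -/(tB th).
  by rewrite min_r ?max_l //; lra.
have gtA z : P z -> 0 < curve_length (tA th) (shadow K g th z) g.
  by move=> /h4 hz; apply: (curve_length_gt0 hg adr adl); lra.
have gtB z : P z -> 0 < curve_length (shadow K g th z) (tB th) g.
  by move=> /h4 hz; apply: (curve_length_gt0 hg adr adl); lra.
have ratio u v : P u -> P v ->
    log_ratio K P g th u v = theta_potential th u - theta_potential th v.
  move=> Pu Pv; rewrite /log_ratio !lenA// !lenB//.
  rewrite ln_div ?posrE ?mulr_gt0 ?gtA ?gtB// !lnM ?posrE ?gtA ?gtB//.
  by rewrite /theta_potential /potential -/(tA th) -/(tB th); ring.
rewrite /dist_theta -/(shadow K g th x) -/(shadow K g th y).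
case: leP => h; rewrite ratio//.
  by rewrite ger0_norm// subr_ge0; exact: theta_potential_le.
by rewrite distrC ger0_norm// subr_ge0; apply: theta_potential_le => //; exact: ltW.
Qed.

(* A sequence of counterexamples would have segments [th, e th] converging to
   the segment through [x], hence meeting [P]. *)
Lemma tangent_gap (e : X -> X) x : P x ->
  (forall th, frontier K th -> [/\ frontier K (e th), e th <> th &
    forall y, P y -> ~ segment th (e th) y]) ->
  exists2 r, 0 < r & forall th, frontier K th ->
    r <= mdist (second_point K th x) (e th).
Proof.
move=> Px he; apply: contrapT => nex.
have seq (n : nat) : exists th, frontier K th /\
    mdist (second_point K th x) (e th) < n.+1%:R^-1.
  apply: contrapT => nth; apply: nex; exists n.+1%:R^-1; first by rewrite invr_gt0.
  move=> th fth; rewrite leNgt; apply/negP => h; apply: nth; by exists th.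
have [th thP] := choice seq.
have [G [GU FG]] := ultraFilterLemma (eventually_filter : ProperFilter \oo).
have fth i : frontier K (th i) by case: (thP i).
have [t ft Gt] : exists2 p, frontier K p & th @ G --> p.
  apply: ultra_compact_cvg; last exact: filterE.
  exact: (compact_frontier properX K0 bndK).
have Kx := PK Px.
have Gz : second_point K (th i) x @[i --> G] --> second_point K t x.
  by apply: second_point_cvg => //; [exact: filterE|exact: filterE|exact: cvg_cst].
have Ge : e (th i) @[i --> G] --> second_point K t x.
  apply: cvg_mdist0 Gz _; apply: (@cvg_finer _ _ \oo G) => //.
  apply: (@squeeze_cvgr _ _ _ _ (fun=> 0) (fun n => n.+1%:R^-1)).
  - by apply: nearW => i; rewrite mdist_ge0 /=; case: (thP i) => _ /ltW.
  - exact: cvg_cst.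
  - exact: cvg_harmonic.
have [fz zt dz _ xE] := second_pointP g1 properX openK convK K0 bndK ft Kx.
set z := second_point K t x in Gz Ge fz zt dz xE.
have Gd : mdist (th i) x @[i --> G] --> mdist t x by apply: cvg_mdist => //; exact: cvg_cst.
have Gde : mdist (th i) (e (th i)) @[i --> G] --> mdist t z by exact: cvg_mdist.
have Gx : gline (th i) (e (th i)) (mdist (th i) x) @[i --> G] --> x.
  by rewrite [X in _ --> X]xE; apply: gline_cvg => //; exact/nesym.
pose m := (mdist t x + mdist t z) / 2.
have n1 : \forall i \near G, mdist (th i) x < m by apply: (cvgr_lt _ Gd); rewrite /m; lra.
have n2 : \forall i \near G, m < mdist (th i) (e (th i)).
  by apply: (cvgr_gt _ Gde); rewrite /m; lra.
have n3 : \forall i \near G, P (gline (th i) (e (th i)) (mdist (th i) x)).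
  by apply: Gx; exact: open_nbhs_nbhs.
have /filter_ex[i [[a1 a2] a3]] : \forall i \near G,
    (mdist (th i) x < m /\ m < mdist (th i) (e (th i))) /\
    P (gline (th i) (e (th i)) (mdist (th i) x)).
  by apply: filterI => //; exact: filterI.
have [_ nth av] := he _ (fth i); apply: (av _ a3).
rewrite segment_gline//; last exact/nesym.
exists (mdist (th i) x) => //=; rewrite in_itv /= mdist_ge0 /=.
exact: ltW (lt_trans a1 a2).
Qed.

(** Both arc lengths in the potential lie between positive constants independent of [th]: below,
    because an arc is at least as long as its chord and [tangent_gap] bounds the chord; above, by
    the length of a fixed piece of the curve. *)
Lemma theta_potential_bounded x : P x ->
  exists M : R, forall th, frontier K th -> `|theta_potential th x| <= M.
Proof.
move=> Px; have Kx := PK Px.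
have [|r1 r10 hr1] := @tangent_gap (eta_of K P g) x Px.
  move=> th fth; have [[h1 h2] h3 [e1 _] h4 _] := tangentP fth.
  have nth : g (tA th) <> th by apply: (curve_neq_base hg) => //; lra.
  have ft := curve_in hg (tA th); rewrite e1; split => // y Py hy.
  have := shadow_segment g1 properX g openK convK K0 bndK fth ft nth (PK Py) hy.
  rewrite (posE hg) => // [E|]; last lra.
  by have := h4 _ Py; rewrite E ltxx.
have [|r2 r20 hr2] := @tangent_gap (xi_of K P g) x Px.
  move=> th fth; have [[h1 h2] h3 [_ e1] h4 _] := tangentP fth.
  have nth : g (tB th) <> th by apply: (curve_neq_base hg) => //; lra.
  have ft := curve_in hg (tB th); rewrite e1; split => // y Py hy.
  have := shadow_segment g1 properX g openK convK K0 bndK fth ft nth (PK Py) hy.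
  rewrite (posE hg) => // [E|]; last lra.
  by have := h4 _ Py; rewrite E ltxx andbF.
(* The interval [[0, 2]] contains an integer translate of every parameter interval of length at most
   one. *)
pose L a b := curve_length a b g; pose Lam := L 0 2.
have Lle a b : a <= b -> forall th, base g th < a -> b < base g th + 1 -> L a b <= Lam.
  move=> ab th h1 h2; pose z := Num.floor a.
  have hz := floor_itv a; rewrite intrD -/z in hz.
  have <- : L (a - z%:~R) (b - z%:~R) = L a b.
    by have := curve_length_shift hg adr adl (- z) ab; rewrite mulrNz.
  have E1 : L 0 2 = L 0 (a - z%:~R) + L (a - z%:~R) 2.
    by apply: (curve_lengthD adr adl); lra.
  have E2 : L (a - z%:~R) 2 = L (a - z%:~R) (b - z%:~R) + L (b - z%:~R) 2.
    by apply: (curve_lengthD adr adl); lra.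
  have p1 : 0 <= L 0 (a - z%:~R) by apply: (curve_length_ge0 adr adl); lra.
  have p2 : 0 <= L (b - z%:~R) 2 by apply: (curve_length_ge0 adr adl); lra.
  by rewrite /Lam; lra.
exists (ln Lam - ln r1 + (ln Lam - ln r2)) => th fth.
have [[h1 h2] h3 [e1 e2] h4 _] := tangentP fth.
have hx := h4 _ Px; have [_ gp] := shP fth Kx; set p := shadow K g th x in hx gp.
have a1 : r1 <= L (tA th) p.
  apply: le_trans (hr1 _ fth) _; rewrite metric_sym e1 -gp.
  by apply: (curve_length_ge adr adl); lra.
have a2 : r2 <= L p (tB th).
  apply: le_trans (hr2 _ fth) _; rewrite e2 -gp.
  by apply: (curve_length_ge adr adl); lra.
have b1 : L (tA th) p <= Lam by apply: (Lle _ _ _ th); lra.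
have b2 : L p (tB th) <= Lam by apply: (Lle _ _ _ th); lra.
have c1 : ln r1 <= ln (L (tA th) p) <= ln Lam by rewrite !ler_ln ?posrE ?a1 ?b1//; lra.
have c2 : ln r2 <= ln (L p (tB th)) <= ln Lam by rewrite !ler_ln ?posrE ?a2 ?b2//; lra.
by rewrite /theta_potential /potential -/p -/(tA th) -/(tB th) -!/(L _ _) ler_norml; lra.
Qed.

Lemma theta_potential_between th (c : R -> X) s r u : frontier K th ->
  isoline c -> s < r -> r < u -> P (c s) -> P (c u) ->
  theta_potential th (c s) <= theta_potential th (c r) <= theta_potential th (c u) \/
  theta_potential th (c u) <= theta_potential th (c r) <= theta_potential th (c s).
Proof.
move=> fth ci sr ru Ps Pu.
have Pr : P (c r) by apply: (convex_isoline g1 convP ci Ps Pu); rewrite !ltW.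
have := shadow_between g1 properX openK convK K0 bndK hg fth ci sr ru (PK Ps) (PK Pu).
case: asboolP => [_ [E1 E2]|_ [h|h]]; [left|left|right];
  by apply/andP; split; apply: theta_potential_le; rewrite ?E1 ?E2//; lra.
Qed.

Lemma theta_potential_cont th (c : R -> X) t : frontier K th -> isoline c -> P (c t) ->
  theta_potential th (c s) @[s --> t] --> theta_potential th (c t).
Proof.
move=> fth ci Pt; have [[h1 h2] h3 _ h4 _] := tangentP fth.
have ct : c s @[s --> t] --> c t by exact: isoline_cont.
apply: (potential_cvg hg adr adl) => //; try (rewrite -/(tA th) -/(tB th); lra).
  exact: h4.
apply: sh_cvg => //; first exact: PK.
by apply: ct; apply: open_nbhs_nbhs; split => //; exact: PK.
Qed.

Lemma outside_strict th x y z : frontier K th -> P x -> P y -> P z ->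
  (shadow K g th y < shadow K g th x /\ shadow K g th y < shadow K g th z) \/
  (shadow K g th x < shadow K g th y /\ shadow K g th z < shadow K g th y) ->
  `|theta_potential th x - theta_potential th z| <
  `|theta_potential th x - theta_potential th y| +
  `|theta_potential th y - theta_potential th z|.
Proof.
move=> fth Px Py Pz h; apply: ltr_dist_outside.
by case: h => -[h1 h2]; [left|right]; split; exact: theta_potential_lt.
Qed.

Variable theta : nat -> X.
Hypothesis thetaK : range theta `<=` frontier K.
Hypothesis dense_theta : frontier K `<=` closure (range theta).
Hypothesis sides_theta : forall (e : X * X) (s : set X), e \in sidesP ->
  line_of s -> segment e.1 e.2 `<=` s -> s `&` frontier K `<=` range theta.

Let fth i : frontier K (theta i).
Proof. by apply: thetaK; exists i. Qed.

(** Otherwise density would put the whole frontier of [K] on the line, as lines are closed. But a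
    line through a point of [K] has only two frontier points, while the parameters [0], [1 / 3] and
    [2 / 3] give three. *)
Lemma theta_off_line (c : R -> X) s : isoline c -> K (c s) ->
  exists i, ~ range c (theta i).
Proof.
move=> ci Ks; apply: contrapT => nex.
have on i : range c (theta i) by apply: contrapT => h; apply: nex; exists i.
have all z : frontier K z -> range c z.
  move=> /dense_theta cz; apply: (closed_isoline ci).
  by apply: closure_subset cz => _ [i _ <-].
have f t : frontier K (g t) := curve_in hg t.
have [a1 _ e1] := all _ (f 0); have [a2 _ e2] := all _ (f (1 / 3)).
have [a3 _ e3] := all _ (f (2 / 3)).
have spE a b : a <> b -> frontier K (c a) -> frontier K (c b) ->
    second_point K (c a) (c s) = c b.
  by move=> *; exact: (second_point_eq g1 properX openK convK K0 bndK ci).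
have ne u v a b : c a = g u -> c b = g v -> u < v -> v < u + 1 -> a <> b.
  move=> ea eb uv vu E; have : u = v.
    by apply: (curve_inj hg); [rewrite -ea -eb E|rewrite ltr_norml; lra].
  by lra.
have E2 := spE a1 a2 (ne _ _ _ _ e1 e2 (ltac:(lra)) (ltac:(lra))).
have E3 := spE a1 a3 (ne _ _ _ _ e1 e3 (ltac:(lra)) (ltac:(lra))).
apply: (ne _ _ _ _ e2 e3 (ltac:(lra)) (ltac:(lra))).
have f1 : frontier K (c a1) by rewrite e1.
have f2 : frontier K (c a2) by rewrite e2.
have f3 : frontier K (c a3) by rewrite e3.
by apply: (isoline_inj ci); rewrite -(E2 f1 f2) -(E3 f1 f3).
Qed.

(* Seen from an end of the line through [x] and [z], the points [x] and [z] have
   the same shadow while [y] has another one; this persists for nearby [theta i]. *)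
Lemma theta_separates x y z : P x -> P y -> P z -> ~ segment x z y ->
  exists i, (shadow K g (theta i) y < shadow K g (theta i) x /\
             shadow K g (theta i) y < shadow K g (theta i) z) \/
            (shadow K g (theta i) x < shadow K g (theta i) y /\
             shadow K g (theta i) z < shadow K g (theta i) y).
Proof.
move=> Px Py Pz nxzy; have [Kx [Ky Kz]] := (PK Px, (PK Py, PK Pz)).
have [xz|/eqP xz] := eqVneq x z.
  have xy : x <> y by move=> E; apply: nxzy; rewrite -xz E segmentxx.
  have ci := gline_iso g1 xy.
  have [|i ni] := @theta_off_line (gline x y) 0 ci; first by rewrite gline0.
  exists i; rewrite -xz; apply: contrapT => h; apply: ni.
  apply: (@sh_eq _ (fth i) (gline x y) 0 (mdist x y)) => //.
  - by move=> /esym /mdist_positivity.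
  - by rewrite gline0.
  - by rewrite gline1.
  rewrite gline0 gline1//; apply/eqP; rewrite eq_le !leNgt; apply/andP; split.
    by apply/negP => h'; apply: h; left.
  by apply/negP => h'; apply: h; right.
have ci := gline_iso g1 xz; set c := gline x z in ci.
have c0 : c 0 = x by exact: gline0.
have cD : c (mdist x z) = z by exact: gline1.
have D0 : 0 < mdist x z by rewrite mdist_gt0; exact/eqP.
have Kc0 : K (c 0) by rewrite c0.
have KcD : K (c (mdist x z)) by rewrite cD.
(* If [y] is on the line but beyond [x] or [z], monotonicity of the shadow seen from any [theta i]
   off the line already separates; only a [y] off the line requires a limit. *)
have [[s _ sE]|ny] := pselect (range c y).
  have [i ni] := theta_off_line ci Kc0; exists i.
  have Ks : K (c s) by rewrite sE.
  have bt := shadow_between g1 properX openK convK K0 bndK hg (fth i) ci.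
  have [s0|s0] := ltP s 0.
    have := bt _ _ _ s0 D0 Ks KcD; rewrite asboolF// c0 cD sE.
    by move=> [h|h]; [left|right]; split; lra.
  have Ds : mdist x z < s.
    rewrite ltNge; apply/negP => h; apply: nxzy; rewrite segment_gline//.
    by exists s => //=; rewrite in_itv /= s0.
  have := bt _ _ _ D0 Ds Kc0 Ks; rewrite asboolF// c0 cD sE.
  by move=> [h|h]; [right|left]; split; lra.
have [T [T0 fT _ _]] := exit_point g1 properX openK convK K0 bndK ci Kc0.
apply: contrapT => nex.
have btw i : shadow K g (theta i) x <= shadow K g (theta i) y <= shadow K g (theta i) z \/
    shadow K g (theta i) z <= shadow K g (theta i) y <= shadow K g (theta i) x.
  have [h1|h1] := leP (shadow K g (theta i) x) (shadow K g (theta i) y).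
    have [h2|h2] := leP (shadow K g (theta i) y) (shadow K g (theta i) z); first by left.
    have [E|ne] := eqVneq (shadow K g (theta i) x) (shadow K g (theta i) y).
      by right; rewrite (ltW h2) E lexx.
    by exfalso; apply: nex; exists i; right; split => //; rewrite lt_neqAle ne.
  have [h2|h2] := leP (shadow K g (theta i) z) (shadow K g (theta i) y).
    by right; rewrite (ltW h1).
  by exfalso; apply: nex; exists i; left.
(* The filter of indices [i] for which [theta i] approaches the end [c T] of the line; it is proper
   by density. *)
pose F := filter_from (nbhs (c T)) (fun B => theta @^-1` B).
have PF : ProperFilter F.
  apply: filter_from_proper.
    apply: filter_from_filter; first by exists setT; exact: filterT.
    by move=> A B hA hB; exists (A `&` B) => //; exact: filterI.
  by move=> B hB; have [_ [[i _ <-] Bi]] := dense_theta fT hB; exists i.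
have [G [GU FG]] := ultraFilterLemma PF.
have Gth : theta @ G --> c T by move=> B hB; apply: FG; exists B.
have sp_cvg u : K u -> second_point K (theta i) u @[i --> G] --> second_point K (c T) u.
  move=> Ku; apply: (second_point_cvg g1 properX openK convK K0 bndK) => //.
  - exact: filterE.
  - exact: filterE.
  - exact: cvg_cst.
have spP u i : K u -> frontier K (second_point K (theta i) u) /\
    second_point K (theta i) u <> theta i.
  by move=> Ku; have [? ? _ _ _] := second_pointP g1 properX openK convK K0 bndK (fth i) Ku.
have E : shadow K g (c T) x = shadow K g (c T) z.
  rewrite -c0 -cD.
  exact: (collinear_shadow_eq g1 properX g openK convK K0 bndK fT ci (erefl (c T))).
have spE : second_point K (c T) x = second_point K (c T) z.
  by rewrite -(shP fT Kx).2 E (shP fT Kz).2.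
have ntx : c T <> second_point K (c T) x.
  by have [_ /nesym] := second_pointP g1 properX openK convK K0 bndK fT Kx.
(* If [y] were weakly between [x] and [z] from every [theta i], its second point would be squeezed
   between two that merge in the limit. Then [c T] would lie on the line through [x] and [y],
   forcing [y] onto the line of [x] and [z]. *)
have rq : second_point K (c T) y = second_point K (c T) x.
  have [h|h] := in_ultra_setVsetC [set i | shadow K g (theta i) x <=
      shadow K g (theta i) y <= shadow K g (theta i) z] GU.
    apply: (@pos_between_lim _ _ _ _ hg _ G GU theta
      (fun i => second_point K (theta i) x) (fun i => second_point K (theta i) y)
      (fun i => second_point K (theta i) z) (c T)) => //.
    - by apply: filterE => i; split; apply: (spP _ _ _).1.
    - by apply: filterE => i; split; apply: (spP _ _ _).2.
    - exact: sp_cvg.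
    - exact: sp_cvg.
    - by rewrite spE; exact: sp_cvg.
  apply: (@pos_between_lim _ _ _ _ hg _ G GU theta
    (fun i => second_point K (theta i) z) (fun i => second_point K (theta i) y)
    (fun i => second_point K (theta i) x) (c T)) => //.
  - by apply: filterE => i; split; apply: (spP _ _ _).1.
  - by apply: filterE => i; split; apply: (spP _ _ _).2.
  - by rewrite spE; exact: sp_cvg.
  - exact: sp_cvg.
  - exact: sp_cvg.
  - by apply: filterS h => i /=; have [b|//] := btw i; rewrite b.
have xy : x <> y by move=> Exy; apply: ny; exists 0 => //; rewrite c0.
have ci' := gline_iso g1 xy.
have [t _ tE] : range (gline x y) (c T).
  apply: (@sh_eq _ fT (gline x y) 0 (mdist x y)) => //.
  - by move=> /esym /mdist_positivity.
  - by rewrite gline0.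
  - by rewrite gline1.
  by rewrite gline0 gline1// /shadow rq.
apply: ny.
rewrite -(line_of_uniq g1 (isoline_line_of ci') ci (a := 0) (b := T)).
- by exists (mdist x y) => //; rewrite gline1.
- by move=> h; rewrite -h ltxx in T0.
- by rewrite c0; exists 0 => //; rewrite gline0.
- by exists t.
Qed.

(** A point of [P] on the line beyond one end of the side would, together with the other end in the
    closure of [P], force the nearer end into [P]. *)
Lemma side_line_disjoint e : e \in sidesP -> range (gline e.1 e.2) `&` P = set0.
Proof.
move=> es; case: polyP => _ _ _ _ [ne fP]; have e12 := ne _ es.
have ci := gline_iso g1 e12; set c := gline e.1 e.2 in ci *.
have fc t : 0 <= t <= mdist e.1 e.2 -> frontier P (c t).
  by move=> ht; rewrite fP; exists e => //; rewrite segment_gline//; exists t.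
have nPc t : 0 <= t <= mdist e.1 e.2 -> closure P (c t) /\ ~ P (c t).
  by move=> /fc /(frontierP openP).
have D0 : 0 < mdist e.1 e.2 by rewrite mdist_gt0; exact/eqP.
rewrite -subset0 => _ [[t _ <-] Pt].
have [cl0 nP0] := nPc 0 (ltac:(lra)).
have [clD nPD] := nPc (mdist e.1 e.2) (ltac:(lra)).
have [t0|t0] := ltP t 0.
  apply: nP0; apply: (open_convex_lt g1 properX openP convP ci Pt clD); lra.
have [tD|Dt] := leP t (mdist e.1 e.2).
  by have [] := nPc t; first by rewrite t0.
apply: nPD; apply: (open_convex_gt g1 properX openP convP ci Pt cl0); lra.
Qed.

(* The line of a side through [q] is a supporting line, so from its ends on the
   frontier of [K] the shadow of [q] is an end of the shadow of [P]. *)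
Lemma theta_potential_blowup q : frontier P q -> exists i,
  forall (I : Type) (F : set_system I) (FF : Filter F) (x : I -> X) (M : R),
  (\forall j \near F, P (x j)) -> x @ F --> q ->
  \forall j \near F, M <= `|theta_potential (theta i) (x j)|.
Proof.
move=> fq; case: (polyP) => _ _ _ _ [ne fP].
have [e /= es eq] : exists2 e, e \in sidesP & segment e.1 e.2 q.
  by move: fq; rewrite fP => -[e es ?]; exists e.
have e12 := ne _ es; have ci := gline_iso g1 e12; set c := gline e.1 e.2 in ci.
have sdis := side_line_disjoint es; rewrite -/c in sdis.
have Kc0 : K (c 0).
  rewrite /c gline0; apply: subPK; right; rewrite fP; exists e => //.
  exact: segment_endl.
have [T [T0 fT _ _]] := exit_point g1 properX openK convK K0 bndK ci Kc0.
have segc : segment e.1 e.2 `<=` range c.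
  by rewrite segment_gline// => _ [t _ <-]; exists t.
have [i _ iE] : range theta (c T).
  have sub := sides_theta es (isoline_line_of ci) segc.
  by apply: (sub (c T)); split => //; exists T.
exists i; rewrite iE; have [[h1 h2] h3 _ h4 h5] := tangentP fT.
have [clq nPq] := (frontierP openP _).1 fq; have Kq := clPK clq.
have /andP[qA qB] := shadow_closure_le g1 properX openK convK K0 bndK hg clPK fT clq h4.
(* Otherwise some [y] in [P] has the same shadow as [q]. The line through [y] and [q] then passes
   through [c T], so it is the line of the side, which misses [P]. *)
have qend : shadow K g (c T) q = tA (c T) \/ shadow K g (c T) q = tB (c T).
  apply: contrapT => /not_orP[/eqP n1 /eqP n2].
  have [|y Py yE] := h5 (shadow K g (c T) q).
    by rewrite !lt_neqAle qA qB n2 eq_sym n1.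
  have yq : y <> q by move=> E; apply: nPq; rewrite -E.
  have cyq := gline_iso g1 yq.
  have [t _ tE] : range (gline y q) (c T).
    apply: (@sh_eq _ fT (gline y q) 0 (mdist y q)) => //.
    - by move=> /esym /mdist_positivity.
    - by rewrite gline0; exact: PK.
    - by rewrite gline1.
    by rewrite gline0 gline1// yE.
  have [s _ sE] := segc _ eq.
  have sT : s <> T.
    move=> E; have [_ []] := (frontierP openK _).1 fT; by rewrite -E sE.
  suff : (range c `&` P) y by rewrite sdis.
  split => //; rewrite -(line_of_uniq g1 (isoline_line_of cyq) ci sT).
  - by exists 0 => //; rewrite gline0.
  - by rewrite sE; exists (mdist y q) => //; rewrite gline1.
  - by exists t.
move=> I F FF x M FP xq.
have Fsh : shadow K g (c T) (x j) @[j --> F] --> shadow K g (c T) q.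
  by apply: sh_cvg => //; apply: filterS FP => j; exact: PK.
have FAB : \forall j \near F, tA (c T) < shadow K g (c T) (x j) < tB (c T).
  by apply: filterS FP => j; exact: h4.
have BA : tB (c T) < tA (c T) + 1 by lra.
case: qend => E; rewrite E in Fsh.
  have : \forall j \near F, theta_potential (c T) (x j) <= - M.
    exact: (potential_ninfty hg adr adl).
  apply: filterS => j h; have := lerNnormlW (lexx `|theta_potential (c T) (x j)|).
  by lra.
have : \forall j \near F, M <= theta_potential (c T) (x j).
  exact: (potential_pinfty hg adr adl).
by apply: filterS => j h; rewrite (le_trans h)// ler_norm.
Qed.

End polygon_geometry.

Theorem mainTheorem5 (R : realType) (X : metricType R)
    (properX : proper_space X)
    (geodesicX : geodesic_space setT (@mdist R X))
    (planeX : homeomorphic X (R * R)%type)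
    (circleX : homeomorphic (ideal_boundary X) (set_type (@unit_circle R)))
    (diskX : homeomorphic (compactification X)
                          (set_type (@closed_unit_disk R)))
    (g1 : G1 X) (g2 : G2 X) (g3 : G3 X)
    (P K : set X) (sidesP : seq (X * X))
    (polyP : polygon_with_sides P sidesP) (polyK : convex_polygon K)
    (subPK : P `|` frontier P `<=` K)
    (g : R -> X) (clockwiseK : clockwise_parametrization (frontier K) g)
    (theta : nat -> X)
    (thetaK : range theta `<=` frontier K)
    (dense_theta : frontier K `<=` closure (range theta))
    (sides_theta : forall (e : X * X) (s : set X), e \in sidesP ->
       line_of s -> segment e.1 e.2 `<=` s ->
       s `&` frontier K `<=` range theta)
    (w : nat -> R) (w_gt0 : forall i, 0 < w i) (w_sum : cvgn (series w)) :
  let d := polygon_dist K P g theta w in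
  [/\ metric_on P d,
      geodesic_space P d,
      [set S | geodesic_line P d S] =
        [set s `&` P | s in [set s | line_of s /\ s `&` P !=set0]],
      uniquely_geodesic P d &
      geodesically_complete P d].
Proof.
have [sidesK hK] := polyK.
have fth i : frontier K (theta i) by apply: thetaK; exists i.
have [P0 oP bP cP _] := polyP; have [_ oK _ _ _] := hK.
apply: (@weighted_sum_geodesics R X g1 properX P oP cP bP _
  (fun i => theta_potential K P g (theta i)) w) => //.
- exists (g 0) => Pg; have := curve_in clockwiseK 0.
  by move=> /(frontierP oK)[_]; apply; apply: subPK; left.
- move=> x y Px Py; rewrite /polygon_dist; congr (limn (series _)).
  apply/funext => i.
  by rewrite (dist_thetaE g1 properX hK polyP subPK clockwiseK (fth i) Px Py).
- move=> x Px.
  have [M hM] := theta_potential_bounded g1 properX hK polyP subPK clockwiseK Px.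
  by exists M => i; exact: hM.
- by move=> c s r u i ci sr ru Ps Pu;
    exact: (theta_potential_between g1 properX hK polyP subPK clockwiseK (fth i)).
- move=> x y z Px Py Pz nxzy.
  have [i hi] := theta_separates g1 properX hK subPK clockwiseK thetaK dense_theta
    Px Py Pz nxzy.
  by exists i; exact: (outside_strict g1 properX hK polyP subPK clockwiseK (fth i)).
- by move=> c t i ci Pt;
    exact: (theta_potential_cont g1 properX hK polyP subPK clockwiseK (fth i)).
- by move=> q; exact: (theta_potential_blowup g1 properX hK polyP subPK clockwiseK
    sides_theta).
Qed.
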